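(* Let $\Bbbk$ be a field and let $d,r,t$ be integers with $r,t\geq 2$ and $r\leq d\leq rt$. Then there exists a finite simple graph $G$ having no isolated vertex such that $\Delta(G)$ is Cohen--Macaulay over $\Bbbk$ and $$\dim(\Delta(G))=d-1,\qquad \operatorname{reg}(\Delta(G))=r,\qquad \operatorname{type}(\Delta(G))=t.$$
   Context: For a finite simple graph $G$ with vertex set $V(G)=\{v_1,\dots,v_n\}$ and edge set $E(G)$, a subset $W\subset V(G)$ is independent if $\{v,w\}\notin E(G)$ for all $v,w\in W$. The independent complex of $G$ is the simplicial complex $\Delta(G)=\{W\subset V(G): W \text{ is independent in } G\}$. The dimension of a simplicial complex $\Delta$ is $\dim(\Delta)=\max\{|F|-1:F\in\Delta\}$. For a simplicial complex $\Delta$ on $\{v_1,\dots,v_n\}$, let $S=\Bbbk[x_1,\dots,x_n]$ with the standard grading, let $I_\Delta\subset S$ be the ideal generated by all squarefree monomials $x_{i_1}\cdots x_{i_\ell}$ with $\{v_{i_1},\dots,v_{i_\ell}\}\notin\Delta$, and let $\Bbbk[\Delta]=S/I_\Delta$ (the Stanley--Reisner ring). Its Krull dimension is $\dim(\Delta)+1$. $\Delta$ is Cohen--Macaulay over $\Bbbk$ if $\Bbbk[\Delta]$ is a Cohen--Macaulay ring. (For $\Delta=\Delta(G)$, $I_\Delta$ is the edge ideal $(x_ix_j:\{v_i,v_j\}\in E(G))$.) $\operatorname{reg}(\Delta)$ is the Castelnuovo--Mumford regularity of $\Bbbk[\Delta]$ as a graded $S$-module, i.e. $\operatorname{reg}(\Delta)=\max\{j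 : \operatorname{Tor}_i^S(\Bbbk,\Bbbk[\Delta])_{i+j}\neq 0 \text{ for some } i\}$. For $\Delta$ Cohen--Macaulay with $n$ vertices, $\operatorname{type}(\Delta)$ is the Cohen--Macaulay type of $\Bbbk[\Delta]$, i.e. $\operatorname{type}(\Delta)=\dim_\Bbbk \operatorname{Tor}_{c}^S(\Bbbk,\Bbbk[\Delta])$ with $c=n-\dim(\Delta)-1$. *)

(* Defs.v *)
From HB Require Import structures.
From mathcomp Require Import all_boot all_order all_algebra.
From mathcomp Require Import boolp.
From mathcomp Require Import ring_quotient mpoly.

Set Implicit Arguments.
Unset Strict Implicit.
Unset Printing Implicit Defensive.

Import Order.TTheory GRing.Theory Num.Theory.
Local Open Scope ring_scope.
Local Open Scope quotient_scope.

Definition is_max (P : nat -> Prop) (m : nat) : Prop :=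
  P m /\ forall m', P m' -> (m' <= m)%N.

Section CommutativeAlgebra.
Variable R : comNzRingType.
Implicit Types (A I J P : R -> Prop) (s : seq R).

Definition is_ideal I : Prop :=
  [/\ I 0, (forall x y, I x -> I y -> I (x + y))
    & forall a x, I x -> I (a * x)].

Definition ideal_gen A (x : R) : Prop :=
  forall I, is_ideal I -> (forall a, A a -> I a) -> I x.

Definition noetherian : Prop :=
  forall I, is_ideal I ->
    exists s, forall x, I x <-> ideal_gen (fun a => a \in s) x.

Definition is_prime P : Prop :=
  [/\ is_ideal P, ~ P 1 & forall x y, P (x * y) -> P x \/ P y].

Definition is_maximal P : Prop :=
  [/\ is_ideal P, ~ P 1
    & forall I, is_ideal I -> ~ I 1 -> (forall x, P x -> I x) ->
      forall x, I x -> P x].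

Definition regular_seq s : Prop :=
  ~ ideal_gen (fun a => a \in s) 1 /\
  forall i, (i < size s)%N -> forall y,
    ideal_gen (fun a => a \in take i s) (nth 0 s i * y) ->
    ideal_gen (fun a => a \in take i s) y.

Definition depth P : nat -> Prop :=
  is_max (fun m => exists s,
    [/\ size s = m, regular_seq s & forall x, x \in s -> P x]).

Definition height P : nat -> Prop :=
  is_max (fun m => exists p : nat -> R -> Prop,
    [/\ forall i, (i <= m)%N -> is_prime (p i),
        forall i, (i < m)%N ->
          (forall x, p i x -> p i.+1 x) /\ (exists2 x, p i.+1 x & ~ p i x)
      & forall x, p m x <-> P x]).

(* For P maximal, depth P and height P are the depth and the Krull dimension  *)
(* of the local ring R_P, so this says that every R_P is Cohen-Macaulay       *)
(* (Eisenbud, Commutative Algebra, Section 18.2).                             *)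
Definition cohen_macaulay_ring : Prop :=
  noetherian /\
  forall P, is_maximal P -> exists2 m, depth P m & height P m.

End CommutativeAlgebra.

Record scomplex (n : nat) := SComplex {
  faces :> {set {set 'I_n}};
  faces0 : set0 \in faces;
  faces_down : forall F F' : {set 'I_n},
    F \in faces -> F' \subset F -> F' \in faces }.

Definition scdim n (D : scomplex n) : int :=
  (\max_(F in faces D) #|F|)%N%:Z - 1.

Record sgraph (n : nat) := SGraph {
  edge :> rel 'I_n;
  edge_sym : ssrbool.symmetric edge;
  edge_irrefl : irreflexive edge }.

Definition no_isolated n (G : sgraph n) : Prop :=
  forall v : 'I_n, exists w : 'I_n, edge G v w.

Definition independent n (G : sgraph n) (W : {set 'I_n}) : bool :=
  [forall v in W, forall w in W, ~~ edge G v w].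

Lemma independent0 n (G : sgraph n) :
  set0 \in [set W | independent G W].
Proof. by rewrite inE; apply/forall_inP => v; rewrite inE. Qed.

Lemma independent_down n (G : sgraph n) (F F' : {set 'I_n}) :
  F \in [set W | independent G W] -> F' \subset F ->
  F' \in [set W | independent G W].
Proof.
rewrite !inE => /forall_inP indF /subsetP sub.
apply/forall_inP => v /sub /indF /forall_inP hv.
by apply/forall_inP => w /sub /hv.
Qed.

Definition independent_complex n (G : sgraph n) : scomplex n :=
  SComplex (independent0 G) (@independent_down n G).

Section StanleyReisner.
Variables (k : fieldType) (n : nat) (D : scomplex n).

Definition sr_ideal : {pred {mpoly k[n]}} := fun p =>
  `[< ideal_gen (fun m => exists2 F : {set 'I_n},
        F \notin faces D & m = \prod_(i in F) 'X_i) p >].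

Lemma sr_ideal_closed : idealr_closed sr_ideal.
Proof.
split.
- by apply/asboolP => I [I0 _ _] _.
- apply/negP => /asboolP /(_ (fun p => p.@[fun=> 0] = 0)) h.
  suff: (1 : {mpoly k[n]}).@[fun=> 0] = 0 by rewrite meval1; apply/eqP/oner_neq0.
  apply: h => [|_ [F FD ->]].
    split; first exact: meval0.
      by move=> x y; rewrite mevalD => -> ->; rewrite addr0.
    by move=> a x; rewrite mevalM => ->; rewrite mulr0.
  case: (set_0Vmem F) => [F0|[i iF]]; first by rewrite F0 faces0 in FD.
  by rewrite (bigD1 i) //= mevalM mevalXU mul0r.
- move=> a u v /asboolP hu /asboolP hv; apply/asboolP => I Iid genI.
  have [_ ID IM] := Iid.
  by apply: ID; [apply: IM; apply: hu | apply: hv].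
Qed.

HB.instance Definition _ :=
  isIdealr.Build {mpoly k[n]} sr_ideal sr_ideal_closed.

Definition sr_ring : comNzRingType := {ideal_quot sr_ideal}.

Definition sr_pi (p : {mpoly k[n]}) : sr_ring := \pi_({ideal_quot sr_ideal}) p.

End StanleyReisner.

Definition free_map (R : comNzRingType) (A B : finType) (d : A -> B -> R)
    (v : {ffun A -> R}) : {ffun B -> R} :=
  [ffun b => \sum_a v a * d a b].

(* A graded free resolution  ... -> F_1 -> F_0 -> k -> 0  over                *)
(* S = k[x_1, ..., x_n], where F_i is free on the basis gr_basis i, the basis *)
(* element b lying in degree gr_deg b, and where S acts on k through          *)
(* p |-> p.@[0].  Degrees of basis elements are taken nonnegative, which      *)
(* loses nothing since S and k vanish in negative degrees.                    *)
Record gr_free_resolution (k : fieldType) (n : nat) := GrFreeResolution {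
  gr_basis : nat -> finType;
  gr_deg : forall i, gr_basis i -> nat;
  gr_diff : forall i, gr_basis i.+1 -> gr_basis i -> {mpoly k[n]};
  gr_aug : gr_basis 0 -> k;
  gr_augment := fun v : {ffun gr_basis 0 -> {mpoly k[n]}} =>
    \sum_b (v b).@[fun=> 0] * gr_aug b;
  gr_diff_homog : forall i (a : gr_basis i.+1) (b : gr_basis i),
    gr_diff a b = 0 \/
    exists2 e, (e + gr_deg b = gr_deg a)%N & gr_diff a b \is e.-homog;
  gr_aug_homog : forall b, gr_aug b = 0 \/ gr_deg b = 0%N;
  gr_aug_surj : forall c, exists v, gr_augment v = c;
  gr_exact0 : forall v, gr_augment v = 0 <->
    exists w, v = free_map (@gr_diff 0) w;
  gr_exactS : forall i v, free_map (@gr_diff i) v = 0 <->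
    exists w, v = free_map (@gr_diff i.+1) w }.

(* Tor_i^S(k, k[D]) as the homology of F (x)_S k[D], for F a graded free      *)
(* resolution of k.                                                           *)
Section Tor.
Variables (k : fieldType) (n : nat) (D : scomplex n).
Variable F : gr_free_resolution k n.
Local Notation Q := (sr_ring k D).

Definition tens_diff i :
    {ffun gr_basis F i.+1 -> Q} -> {ffun gr_basis F i -> Q} :=
  free_map (fun a b => sr_pi D (gr_diff a b)).

Definition tens_cycle i : {ffun gr_basis F i -> Q} -> Prop :=
  match i with
  | 0 => fun=> True
  | i'.+1 => fun z => tens_diff z = 0
  end.

Definition tens_boundary i (z : {ffun gr_basis F i -> Q}) : Prop :=
  exists w, z = tens_diff w.

Definition tens_homog i (m : nat) (z : {ffun gr_basis F i -> Q}) : Prop :=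
  forall b, z b = 0 \/
    exists e (p : {mpoly k[n]}),
      [/\ (e + gr_deg b = m)%N, p \is e.-homog & z b = sr_pi D p].

(* Tor_i(k, k[D])_m <> 0 *)
Definition tor_neq0 (i m : nat) : Prop :=
  exists z : {ffun gr_basis F i -> Q},
    [/\ tens_cycle z, tens_homog m z & ~ tens_boundary z].

Definition tens_comb i t (c : 'I_t -> k)
    (z : 'I_t -> {ffun gr_basis F i -> Q}) : {ffun gr_basis F i -> Q} :=
  [ffun b => \sum_(l < t) sr_pi D (c l)%:MP * z l b].

(* dim_k Tor_i(k, k[D]) = t : some t cycles form a k-basis modulo boundaries. *)
Definition tor_dim (i t : nat) : Prop :=
  exists z : 'I_t -> {ffun gr_basis F i -> Q},
    [/\ forall l, tens_cycle (z l),
        forall y, tens_cycle y -> exists c, tens_boundary (y - tens_comb c z)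
      & forall c, tens_boundary (tens_comb c z) -> forall l, c l = 0].

End Tor.

Section Invariants.
Variables (k : fieldType) (n : nat) (D : scomplex n).

Definition cohen_macaulay : Prop := cohen_macaulay_ring (sr_ring k D).

(* Tor does not depend on the resolution chosen, hence neither do these two   *)
(* invariants.  In the first, m is the total degree i + j, where j may be     *)
(* negative.                                                                  *)
Definition has_reg (r : nat) : Prop :=
  exists F : gr_free_resolution k n,
    (exists i, tor_neq0 D F i (i + r)%N) /\
    (forall i m, tor_neq0 D F i m -> m%:Z - i%:Z <= r%:Z).

Definition has_type (t : nat) : Prop :=
  exists (F : gr_free_resolution k n) (c : nat),
    c%:Z = n%:Z - scdim D - 1 /\ tor_dim D F c t.

End Invariants.

(* Main.v *)
(* Given a graph on the x_a whose vertices are partitioned into d cliques,    *)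
(* join a new vertex w_c to all of the c-th clique.  Put theta_c = w_c + the  *)
(* sum of the x_a in the clique c.  Since x_a ^ 2 = theta_c x_a in the        *)
(* Stanley-Reisner ring R of the whiskered graph, R is free over k[theta]     *)
(* with basis the squarefree monomials x^F, F an independent set of the       *)
(* given graph, so R has dimension d and the theta_c form a regular sequence. *)
(* Reducing the Koszul complex on the theta_c and x_a modulo the theta_c      *)
(* leaves that of R / (theta), which has degrees up to the independence       *)
(* number and whose socle is spanned by the maximal independent sets: these   *)
(* two numbers are the regularity and the type.                               *)
(*   For the theorem take the complete t-partite graph with parts of size r:  *)
(* the t parts are its maximal independent sets, and as r <= d <= rt its rt   *)
(* vertices are partitioned into d nonempty cliques by their residue mod d.   *)
(*   For a maximal ideal P, the Nullstellensatz gives nonzero polynomials f_c *)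
(* with f_c(theta_c) in P; these form a regular sequence, and yield a chain   *)
(* of d + 1 primes ending in P.  No longer sequence or chain exists, as it    *)
(* would give more than d algebraically independent elements.                 *)
Require Import Defs.
From HB Require Import structures.
From mathcomp Require Import all_boot all_order all_algebra.
From mathcomp Require Import boolp ring_quotient mpoly ring zify.

Set Implicit Arguments.
Unset Strict Implicit.
Unset Printing Implicit Defensive.

Import Order.TTheory GRing.Theory Num.Theory.
Local Open Scope ring_scope.
Local Open Scope quotient_scope.

(** * Ideals, noetherianity and Zariski's lemma *)

(** Write [R] for the Stanley-Reisner ring of the whiskered graph and [B] for a polynomial ring in
    [d] variables, mapped to [R] by sending its variables to the thetas. Everything rests on [R]
    being a free [B]-module on the squarefree monomials of the independent sets of the original
    graph. They span by the rule theta x = x^2 ([spanP]), and the projections onto facets separate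
    their coefficients ([span_unique]). Hence regular sequences of [B] stay regular in [R]
    ([regular_param]), and the quotient of [R] by the thetas has an explicit [k]-basis, whose
    coordinates [kap] decide membership in the theta ideal ([thetas_killed]).

    Regularity and type are computed with the Koszul resolution on the coordinates theta_c, x_a. By
    [kosz_reduce] only the coefficients modulo the thetas matter. They vanish in degrees above the
    independence number ([tor_vanish]). In exterior degree [N] the homology is the socle of the
    quotient, with basis the maximal independent sets, each realised by an explicit cycle [cyc]
    ([reg_witness], [tor_type]).

    For Cohen-Macaulayness, noetherianity is Hilbert's basis theorem. At a maximal ideal the
    residues of the thetas are algebraic over [k] by [zariski], which yields both a regular sequence
    of length [d] ([depth_eq]) and a chain of primes of length [d] ([height_eq]). The upper bounds
    share one argument: regular sequences and prime chains both give ideals a_0, a_1, ... with an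
    element of a_(i+1) regular modulo a_i, and [regular_chain_bound] limits the length of such a
    chain by counting monomials. *)

Section Ideals.
Variable R : comNzRingType.
Implicit Types (I J : R -> Prop) (s : seq R).

Lemma ideal_gen_ideal (A : R -> Prop) : is_ideal (ideal_gen A).
Proof.
split=> [I [] //|x y hx hy I Iid AI|a x hx I Iid AI].
  by have [_ ID _] := Iid; apply: ID; [apply: hx | apply: hy].
by have [_ _ IM] := Iid; apply: IM; apply: hx.
Qed.

Lemma mem_ideal_gen (A : R -> Prop) a : A a -> ideal_gen A a.
Proof. by move=> Aa I _; apply. Qed.

Lemma idealN I x : is_ideal I -> I x -> I (- x).
Proof. by case=> _ _ IM Ix; rewrite -mulN1r; apply: IM. Qed.

Lemma idealB I x y : is_ideal I -> I x -> I y -> I (x - y).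
Proof. by move=> Iid Ix Iy; have [_ ID _] := Iid; apply: ID => //; apply: idealN. Qed.

Lemma ideal_sum I (T : Type) (r : seq T) (P : pred T) (F : T -> R) :
  is_ideal I -> (forall i, P i -> I (F i)) -> I (\sum_(i <- r | P i) F i).
Proof. by case=> I0 ID _ IF; elim/big_ind: _. Qed.

Lemma ideal_gen_mono (A A' : R -> Prop) x :
  (forall a, A a -> A' a) -> ideal_gen A x -> ideal_gen A' x.
Proof. by move=> AA' hx I Iid A'I; apply: hx => // a /AA'; apply: A'I. Qed.

Definition zero_ideal (x : R) : Prop := x = 0.

Lemma zero_ideal_ideal : is_ideal zero_ideal.
Proof.
by split=> // [x y -> ->|a x ->]; rewrite /zero_ideal ?addr0 ?mulr0.
Qed.

Definition ideal_add I a : R -> Prop :=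
  fun x => exists2 y, I y & exists b, x = y + b * a.

Lemma ideal_add_ideal I a : is_ideal I -> is_ideal (ideal_add I a).
Proof.
case=> I0 ID IM; split.
- by exists 0 => //; exists 0; rewrite mul0r addr0.
- move=> _ _ [y Iy [b ->]] [z Iz [c ->]]; exists (y + z); first exact: ID.
  by exists (b + c); ring.
- move=> c _ [y Iy [b ->]]; exists (c * y); first exact: IM.
  by exists (c * b); ring.
Qed.

Lemma ideal_addl I a x : I x -> ideal_add I a x.
Proof. by move=> Ix; exists x => //; exists 0; rewrite mul0r addr0. Qed.

Lemma ideal_addr I a b : is_ideal I -> ideal_add I a (b * a).
Proof. by case=> I0 _ _; exists 0 => //; exists b; rewrite add0r. Qed.

(** Adding generators one at a time keeps inductions along a sequence inside ideals of the fixed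
    ring [R], with no quotient rings. *)
Definition ideal_adds I s := foldl ideal_add I s.

Lemma ideal_adds_ideal I s : is_ideal I -> is_ideal (ideal_adds I s).
Proof. by elim: s I => //= a s IH I Iid; apply/IH/ideal_add_ideal. Qed.

Lemma ideal_addsl I s x : I x -> ideal_adds I s x.
Proof. by elim: s I => //= a s IH I Ix; apply/IH/ideal_addl. Qed.

Lemma mem_ideal_adds I s x : is_ideal I -> x \in s -> ideal_adds I s x.
Proof.
elim: s I => //= a s IH I Iid; rewrite inE => /orP[/eqP->|xs].
  by apply: ideal_addsl; have := ideal_addr a 1 Iid; rewrite mul1r.
by apply: IH => //; apply: ideal_add_ideal.
Qed.

Lemma ideal_adds_min I J s x : is_ideal J -> (forall y, I y -> J y) ->
  (forall a, a \in s -> J a) -> ideal_adds I s x -> J x.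
Proof.
move=> Jid; elim: s I => /= [|a s IH] I IJ sJ; first exact: IJ.
apply: IH => [_ [y Iy [b ->]]|b bs]; last by apply: sJ; rewrite inE bs orbT.
have [_ JD JM] := Jid; apply: JD; first exact: IJ.
by apply/JM/sJ; rewrite inE eqxx.
Qed.

Lemma ideal_genE s x :
  ideal_gen (fun a => a \in s) x <-> ideal_adds zero_ideal s x.
Proof.
split=> [hx|].
  apply: hx => [|a]; first exact/ideal_adds_ideal/zero_ideal_ideal.
  exact/mem_ideal_adds/zero_ideal_ideal.
apply: ideal_adds_min => [|_ ->|a]; first exact: ideal_gen_ideal.
  by have [] := ideal_gen_ideal (fun a => a \in s).
exact: (@mem_ideal_gen (fun a => a \in s)).
Qed.

(** The base ideal [J] absorbs the head of the sequence in inductions ([regular_mod_cons]). Unlike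
    in [regular_seq], properness of the generated ideal is not demanded. *)
Definition regular_mod J s : Prop := forall i, (i < size s)%N -> forall y,
  ideal_adds J (take i s) (nth 0 s i * y) -> ideal_adds J (take i s) y.

Lemma regular_mod_cons J a s : regular_mod J (a :: s) <->
  (forall y, J (a * y) -> J y) /\ regular_mod (ideal_add J a) s.
Proof.
split=> [reg|[rega reg]].
  by split=> [y|i]; [have := reg 0%N; apply | have := reg i.+1; apply].
by case=> [|i] /= hi y; [apply: rega | apply: reg].
Qed.

End Ideals.

Section Generated.

(** Generation as a ring by the image of [phi] and by [s], put as an induction principle. *)
Definition generated (R K : nzRingType) (phi : R -> K) (s : seq K) : Prop :=
  forall Q : K -> Prop, (forall a, Q (phi a)) -> (forall u, u \in s -> Q u) ->
    (forall x y, Q x -> Q y -> Q (x + y)) ->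
    (forall x y, Q x -> Q y -> Q (x * y)) -> forall z, Q z.

(** Trades a generator for a variable of the coefficient ring: the inductive step of both
    [noetherian_generated] and [zariski]. *)
Lemma generated_poly (R K : comNzRingType) (phi : {rmorphism R -> K}) s u
    (cu : commr_rmorph phi u) :
  u \in s -> generated phi s -> generated (horner_morph cu) (rem u s).
Proof.
move=> us gen Q Qphi Qs; apply: gen => [a|v].
  by have := Qphi a%:P; rewrite horner_morphC.
rewrite (perm_mem (perm_to_rem us)) inE => /orP[/eqP->|/Qs //].
by have := Qphi 'X; rewrite horner_morphX.
Qed.

End Generated.

Lemma noetherian_image (R Q : comNzRingType) (phi : {rmorphism R -> Q}) :
  (forall z, exists x, phi x = z) -> noetherian R -> noetherian Q.
Proof.
move=> surj noeR I [I0 ID IM].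
have [|s hs] := noeR (I \o phi).
  by split=> [|x y|a x] /=; rewrite ?rmorph0 ?rmorphD ?rmorphM; auto.
exists (map phi s) => z; have [x <-] := surj z; split.
  move/(hs x) => /(_ (fun y => ideal_gen (fun a => a \in map phi s) (phi y))).
  apply=> [|a a_s]; last first.
    by apply: (@mem_ideal_gen _ (fun b => b \in map phi s)); apply: map_f.
  have [g0 gD gM] := ideal_gen_ideal (fun a => a \in map phi s).
  by split=> [|u v|a u]; rewrite ?rmorph0 ?rmorphD ?rmorphM; auto.
apply=> // _ /mapP[a a_s ->]; apply/(hs a).
exact: (@mem_ideal_gen _ (fun a => a \in s)).
Qed.

(** * Hilbert's basis theorem *)

Section HilbertBasis.
Variable R : comNzRingType.
Hypothesis noeR : noetherian R.
Variables (I : {poly R} -> Prop) (Iid : is_ideal I).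

Definition coef_ideal (J : {poly R} -> Prop) e (c : R) : Prop :=
  exists f, [/\ J f, (size f <= e.+1)%N & f`_e = c].

Lemma coef_ideal_ideal J e : is_ideal J -> is_ideal (coef_ideal J e).
Proof.
case=> J0 JD JM; split.
- by exists 0; split; rewrite ?size_poly0 ?coef0.
- move=> _ _ [f [Jf szf <-]] [g [Jg szg <-]]; exists (f + g); split.
  + exact: JD.
  + by rewrite (leq_trans (size_polyD _ _)) // geq_max szf.
  + exact: coefD.
- move=> a _ [f [Jf szf <-]]; exists (a%:P * f); split; first exact: JM.
    by rewrite mul_polyC (leq_trans (size_scale_leq _ _)).
  by rewrite coefCM.
Qed.

Lemma coef_ideal_mono J e e' c : is_ideal J -> (e <= e')%N ->
  coef_ideal J e c -> coef_ideal J e' c.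
Proof.
case=> J0 JD JM lee [f [Jf szf <-]]; exists ('X^(e' - e) * f); split.
- exact: JM.
- rewrite (leq_trans (size_polyMleq _ _)) // size_polyXn /=.
  by rewrite (leq_trans (leq_add (leqnn _) szf)) // addnS subnK.
- by rewrite coefXnM ltnNge leq_subr /= subKn.
Qed.

Lemma finite_coef_lift e : exists2 T : seq {poly R}, (forall g, g \in T -> I g) &
  forall c, coef_ideal I e c -> coef_ideal (ideal_gen (fun a : {poly R} => a \in T)) e c.
Proof.
have [s hs] := noeR (coef_ideal_ideal e Iid).
have {}sI a : a \in s -> coef_ideal I e a.
  by move=> a_s; apply/hs; apply: (@mem_ideal_gen _ (fun a => a \in s)).
have [T TI Ts] : exists2 T : seq {poly R}, (forall g, g \in T -> I g) &
    forall a, a \in s -> coef_ideal (fun g => g \in T) e a.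
  elim: {hs} s sI => [|a s IH] sI; first by exists [::].
  have [|T TI Ts] := IH; first by move=> b bs; apply: sI; rewrite inE bs orbT.
  have [|f [If szf fa]] := sI a; first by rewrite inE eqxx.
  exists (f :: T) => [g|b]; rewrite inE => /orP[/eqP->|]; first exact: If.
  - exact: TI.
  - by exists f; rewrite inE eqxx.
  - by move=> /Ts[g [gT ? ?]]; exists g; split=> //; rewrite inE gT orbT.
exists T => // c /hs; apply; first exact/coef_ideal_ideal/ideal_gen_ideal.
move=> a /Ts[g [gT ? ?]]; exists g; split=> //.
exact: (@mem_ideal_gen _ (fun a : {poly R} => a \in T)).
Qed.

(** The ideals of leading coefficients increase with the degree, and their union is finitely
    generated, so they are stationary from some [D] on. Lifts of generators in the degrees up to [D]
    generate [I], since subtracting a combination of them lowers the degree of any element of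
    [I]. *)
Lemma noetherian_poly_ideal : exists s : seq {poly R},
  forall x, I x <-> ideal_gen (fun a : {poly R} => a \in s) x.
Proof.
have [I0 ID IM] := Iid.
have [|s hs] := noeR (I := fun c => exists e, coef_ideal I e c).
  split.
  - by exists 0%N; have [] := coef_ideal_ideal 0 Iid.
  - move=> x y [e ex] [f fy]; exists (maxn e f).
    have [_ LD _] := coef_ideal_ideal (maxn e f) Iid; apply: LD.
      by apply: coef_ideal_mono ex; rewrite ?leq_maxl.
    by apply: coef_ideal_mono fy; rewrite ?leq_maxr.
  - move=> a x [e ex]; exists e.
    by have [_ _ LM] := coef_ideal_ideal e Iid; apply: LM.
have [D hD] : exists D, forall e c, coef_ideal I e c -> coef_ideal I D c.
  have [D hD] : exists D, forall a, a \in s -> coef_ideal I D a.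
    have : forall a, a \in s -> exists e, coef_ideal I e a.
      by move=> a a_s; apply/hs; apply: (@mem_ideal_gen _ (fun a => a \in s)).
    elim: {hs} s => [|a s IH] sI; first by exists 0%N.
    have [|D hD] := IH; first by move=> b bs; apply: sI; rewrite inE bs orbT.
    have [|e he] := sI a; first by rewrite inE eqxx.
    exists (maxn e D) => b; rewrite inE => /orP[/eqP->|/hD].
      by apply: coef_ideal_mono he; rewrite ?leq_maxl.
    by apply: coef_ideal_mono; rewrite ?leq_maxr.
  exists D => e c ec.
  have /hs : exists e, coef_ideal I e c by exists e.
  by apply=> //; apply: coef_ideal_ideal.
have [T TI hT] : exists2 T : seq {poly R}, (forall g, g \in T -> I g) &
    forall e c, (e <= D)%N -> coef_ideal I e c ->
      coef_ideal (ideal_gen (fun a : {poly R} => a \in T)) e c.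
  elim: D {hD} => [|D [T TI hT]].
    have [T TI hT] := finite_coef_lift 0.
    by exists T => // e c; rewrite leqn0 => /eqP->; apply: hT.
  have [T' TI' hT'] := finite_coef_lift D.+1.
  exists (T ++ T') => [g|e c].
    by rewrite mem_cat => /orP[/TI|/TI'].
  rewrite leq_eqVlt ltnS => /orP[/eqP->|eD].
    move=> /hT'[f [Tf ? ?]]; exists f; split=> //.
    by apply: ideal_gen_mono Tf => g gT; rewrite mem_cat gT orbT.
  move=> /(hT _ _ eD)[f [Tf ? ?]]; exists f; split=> //.
  by apply: ideal_gen_mono Tf => g gT; rewrite mem_cat gT.
exists T => f; split; last by apply=> // a /TI.
have [g0 gD gM] := ideal_gen_ideal (fun a : {poly R} => a \in T).
have [n] := ubnP (size f); elim: n f => // n IH f; rewrite ltnS => szf If.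
have [->//|f0] := eqVneq f 0.
have {g0} [g [Tg szg fg]] :
    coef_ideal (ideal_gen (fun a : {poly R} => a \in T)) (size f).-1 (lead_coef f).
  have Lf : coef_ideal I (size f).-1 (lead_coef f).
    by exists f; rewrite leqSpred.
  have [le_D|/ltnW D_le] := leqP (size f).-1 D; first exact: hT.
  apply: (coef_ideal_mono (ideal_gen_ideal _) D_le).
  by apply: hT => //; apply: hD Lf.
rewrite -(subrK g f); apply: (gD _ _ _ Tg); apply: IH; last first.
  by apply: idealB => //; apply: Tg => // a /TI.
apply: leq_trans szf; have szf : (0 < size f)%N by rewrite size_poly_gt0.
rewrite -(prednK szf) ltnS; apply/leq_sizeP => j.
rewrite leq_eqVlt coefB => /orP[/eqP<-|lt_j]; first by rewrite fg subrr.
by rewrite !nth_default ?subrr ?(leq_trans szg) // -(prednK szf).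
Qed.

End HilbertBasis.

Lemma noetherian_poly (R : comNzRingType) : noetherian R -> noetherian {poly R}.
Proof. by move=> noeR I Iid; apply: noetherian_poly_ideal. Qed.

Lemma noetherian_generated (R K : comNzRingType) (phi : {rmorphism R -> K}) s :
  noetherian R -> generated phi s -> noetherian K.
Proof.
have [n] := ubnP (size s); elim: n R phi s => // n IH R phi [|u s] /=.
  move=> _ noeR gen; apply: (noetherian_image (phi := phi)) noeR.
  apply: gen => [a|//|x y [a <-] [b <-]|x y [a <-] [b <-]]; first by exists a.
    by exists (a + b); rewrite rmorphD.
  by exists (a * b); rewrite rmorphM.
rewrite ltnS => lt_s /noetherian_poly noeR gen.
have cu : commr_rmorph phi u by move=> a; apply: mulrC.
apply: (IH _ (horner_morph cu) (rem u (u :: s))) noeR _.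
  by rewrite /= eqxx.
by apply: generated_poly gen; rewrite inE eqxx.
Qed.

Lemma noetherian_field (F : fieldType) : noetherian F.
Proof.
move=> I Iid; have [I0 _ IM] := Iid.
have [[x Ix x0]|nI] := pselect (exists2 x, I x & x != 0).
  exists [:: 1] => y; split=> _.
    have [_ _ gM] := ideal_gen_ideal (fun a : F => a \in [:: 1]).
    rewrite -[y]mulr1; apply: gM.
    by apply: (@mem_ideal_gen _ (fun a => a \in _)); rewrite inE.
  by rewrite -[y](mulfVK x0); apply: IM.
exists [::] => y; split=> [Iy|]; last by apply.
have [->|y0] := eqVneq y 0; last by case: nI; exists y.
by have [] := ideal_gen_ideal (fun a : F => a \in [::]).
Qed.

Section Zariski.

(** Multiplying the equation of [u], of degree [e], by the power [e - 1] of its leading coefficient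
    [a] gives a monic equation for [a u]. *)
Lemma integral_lead_coefM (R K : comNzRingType) (phi : {rmorphism R -> K})
    (f : {poly R}) u :
  (1 < size f)%N -> root (map_poly phi f) u ->
  integralOver phi (phi (lead_coef f) * u).
Proof.
move=> szf /rootP fu; set a := lead_coef f; set e := (size f).-1.
have szfE : size f = e.+1 by rewrite prednK // ltnW.
have e0 : (0 < e)%N by rewrite /e -subn1 subn_gt0.
pose q := \poly_(i < e) (f`_i * a ^+ (e.-1 - i)).
have szq : (size q < size ('X^e : {poly R}))%N.
  by rewrite size_polyXn ltnS size_poly.
exists ('X^e + q).
  by rewrite monicE lead_coefDl // lead_coefXn.
apply/rootP; rewrite rmorphD /= map_polyXn hornerD hornerXn.
have -> : (map_poly phi q).[phi a * u] =
    phi a ^+ e.-1 * \sum_(i < e) phi f`_i * u ^+ i.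
  rewrite (@horner_coef_wide _ e); last first.
    by rewrite (leq_trans (size_poly _ _)) // size_poly.
  rewrite mulr_sumr; apply: eq_bigr => i _.
  rewrite coef_map coef_poly ltn_ord /= rmorphM rmorphXn exprMn.
  have -> : phi a ^+ e.-1 = phi a ^+ (e.-1 - i) * phi a ^+ i.
    by rewrite -exprD subnK // -ltnS prednK.
  by ring.
have := fu; rewrite (@horner_coef_wide _ e.+1); last first.
  by rewrite -szfE size_poly.
rewrite big_ord_recr /= coef_map -[f`_e]/(lead_coef f) -/a.
under eq_bigr => i _ do rewrite coef_map.
move/(canRL (addrK _)) => ->; rewrite exprMn -[in phi a ^+ e](prednK e0) exprSr.
by ring.
Qed.

(** Modulo b = 1 + aX one has aX = -1, so if [b] divided a power of [a] it would divide a sign; but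
    [b] has positive degree. *)
Lemma polyC_X_unit (A : idomainType) (a c : {poly A}) M :
  a != 0 -> (1 + 'X * a) * c != a ^+ M.
Proof.
move=> a0; apply/eqP => bc; set b := 1 + 'X * a in bc.
have szXa : size ('X * a) = (size a).+1 by rewrite mulrC size_mulX.
have szb : size b = (size a).+1.
  rewrite /b addrC size_polyDl szXa // size_poly1.
  by rewrite ltnS size_poly_gt0.
have : (b %| 1)%R.
  have : (b %| ('X * a) ^+ M - (- 1) ^+ M)%R.
    by rewrite subrXX opprK addrC dvdp_mulr // addrC.
  rewrite dvdp_subr; last by rewrite exprMn -bc mulrCA dvdp_mulr.
  by rewrite -signr_odd; case: odd; rewrite ?expr1 ?dvdpNr.
rewrite dvdp1 szb eqSS size_poly_eq0; exact/negP.
Qed.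

(* Munshi's proof: otherwise each generator is integral over A[X][1/a] for    *)
(* some a <> 0, hence so is K, although 1 + aX divides no power of a.         *)
Lemma zariski (A : idomainType) (K : comNzRingType)
    (phi : {rmorphism {poly A} -> K}) (s : seq K) :
  (forall x : K, x != 0 -> exists y, y * x = 1) -> generated phi s ->
  exists2 p, p != 0 & phi p = 0.
Proof.
move=> Kinv; have [n] := ubnP (size s); elim: n A phi s => // n IH A phi s.
rewrite ltnS => szs gen; apply: contrapT => inj_phi.
have {}inj_phi p : phi p = 0 -> p = 0.
  by move=> p0; apply/eqP/negP => /negP p'0; apply: inj_phi; exists p.
have [a a0 ha] : exists2 a, a != 0 &
    forall u, u \in s -> integralOver phi (phi a * u).
  have : {subset s <= s} by [].
  move: {1 3}s; elim=> [|u s' IHs'] sub; first by exists 1; rewrite ?oner_neq0.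
  have [|a a0 ha] := IHs'; first by move=> v vs; apply: sub; rewrite inE vs orbT.
  have us : u \in s by apply: sub; rewrite inE eqxx.
  have cu : commr_rmorph phi u by move=> b; apply: mulrC.
  (* The induction hypothesis over [{poly A}], with [u] as the extra variable, makes [u] algebraic
     over the image of [phi]. As [phi] is injective, [f] is not constant. *)
  have [|f f0 fu] := IH _ (horner_morph cu) (rem u s) _ (generated_poly us gen).
    have s0 : (0 < size s)%N by case: (s) us.
    by rewrite size_rem // (leq_trans _ szs) // prednK.
  have szf : (1 < size f)%N.
    rewrite ltnNge; apply/negP => /size1_polyC fE.
    move: fu; rewrite fE => /(etrans (esym (horner_morphC cu _)))/inj_phi f00.
    by rewrite fE f00 eqxx in f0.
  have hu := integral_lead_coefM szf (introT rootP fu).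
  exists (a * lead_coef f); first by rewrite mulf_neq0 ?lead_coef_eq0.
  move=> v; rewrite inE => /orP[/eqP->|/ha hv]; rewrite rmorphM.
    by rewrite -mulrA; apply: integral_mul => //; apply: integral_id.
  by rewrite mulrAC mulrC; apply: integral_mul => //; apply: integral_id.
have gN : forall g, exists N, integralOver phi (phi a ^+ N * g).
  have hX k b : integralOver phi b -> integralOver phi (phi a ^+ k * b).
    by move=> hb; rewrite -rmorphXn; apply: integral_mul => //; apply: integral_id.
  apply: gen => [b|u /ha hu|x y [i hx] [j hy]|x y [i hx] [j hy]].
  - by exists 0%N; rewrite expr0 mul1r; apply: integral_id.
  - by exists 1%N.
  - exists (i + j)%N; rewrite mulrDr; apply: integral_add.
      by rewrite addnC exprD -mulrA; apply: hX.
    by rewrite exprD -mulrA; apply: hX.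
  - exists (i + j)%N; rewrite exprD mulrACA; exact: integral_mul.
set b := 1 + 'X * a.
have b0 : phi b != 0.
  apply/eqP => /inj_phi /(congr1 (fun p : {poly A} => p`_0)).
  by rewrite coefD coef1 coefXM coef0 addr0 => /eqP; rewrite oner_eq0.
have [g gb] := Kinv _ b0.
have [M [p p_mon /rootP]] := gN g.
set m := (size p).-1; have szp : size p = m.+1.
  by rewrite prednK // size_poly_gt0 monic_neq0.
rewrite (@horner_coef_wide _ m.+1) -?szp ?size_poly // szp big_ord_recr /=.
have -> : (map_poly phi p)`_m = 1.
  by rewrite coef_map -[RHS](rmorph1 phi); congr (phi _); apply/monicP.
rewrite mul1r.
(* Clearing [g], the inverse of [phi b], from the monic equation of a^M g: the top term becomes a^(M
   m) and every other term is a multiple of [b]. *)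
move=> /(congr1 (fun z => z * phi b ^+ m)); rewrite mul0r mulrDl mulr_suml.
pose c := - \sum_(i < m) p`_i * a ^+ (M * i) * b ^+ (m - i.+1).
move=> hsum; have /negP := polyC_X_unit c (M * m) a0; apply; rewrite -/b.
rewrite -subr_eq0; apply/eqP/inj_phi.
rewrite rmorphB rmorphM /c rmorphN rmorph_sum /= mulrN -opprD.
apply/eqP; rewrite oppr_eq0. rewrite -[X in _ == X]hsum mulr_sumr; apply/eqP; congr (_ + _).
  apply: eq_bigr => i _; rewrite !rmorphM !rmorphXn coef_map exprMn -exprM /=.
  have -> : phi b ^+ m = phi b ^+ i * phi b ^+ (m - i.+1) * phi b.
    by rewrite -exprD -exprSr; congr (_ ^+ _); have := ltn_ord i; lia.
  have : g ^+ i * phi b ^+ i = 1 by rewrite -exprMn gb expr1n.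
  by move=> gbi; rewrite -[LHS]mulr1 -gbi; ring.
by rewrite rmorphXn exprMn -exprM -mulrA -exprMn gb expr1n mulr1.
Qed.

End Zariski.

(** * Bounding regular chains by growth *)

Section MonomialSums.
Variables (k : fieldType) (R : comNzRingType) (iota : {rmorphism k -> R}).
Variable M : nat.

(* The sum of the c l * fs^l over the lists l of exponents in [0, M). *)
Fixpoint mono_sum (fs : seq R) (c : seq nat -> k) : R :=
  if fs is f :: fs' then
    \sum_(j < M) f ^+ j * mono_sum fs' (fun l => c (val j :: l))
  else iota (c [::]).

Lemma mono_sum0 fs c :
  (forall l, size l = size fs -> all (fun j => j < M)%N l -> c l = 0) ->
  mono_sum fs c = 0.
Proof.
elim: fs c => [|f fs IH] c c0 /=; first by rewrite c0 ?rmorph0.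
rewrite big1 // => j _; rewrite IH ?mulr0 // => l szl ltl.
by apply: c0; rewrite /= ?szl ?ltn_ord.
Qed.

Lemma mono_sum_lin fs (T : finType) (u : T -> k) (c : T -> seq nat -> k) :
  mono_sum fs (fun l => \sum_t u t * c t l) =
  \sum_t iota (u t) * mono_sum fs (c t).
Proof.
elim: fs c => [|f fs IH] c /=.
  by rewrite rmorph_sum; apply: eq_bigr => t _; rewrite rmorphM.
under eq_bigr => j _ do rewrite IH mulr_sumr.
rewrite exchange_big; apply: eq_bigr => t _; rewrite mulr_sumr.
by apply: eq_bigr => j _; rewrite mulrCA.
Qed.

(** Expand in powers of the first element [f]. Since [f] lies in [a 1], the constant term lies in
    [a 1] too, so its coefficients vanish by induction on [fs]; [f] is regular modulo [a 0], so it
    can then be divided out. *)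
Lemma mono_sum_indep (a : nat -> R -> Prop) (fs : seq R) (c : seq nat -> k) :
  (forall i, (i <= size fs)%N -> is_ideal (a i)) ->
  (forall i, (i < size fs)%N -> forall x, a i x -> a i.+1 x) ->
  (forall i, (i < size fs)%N -> a i.+1 (nth 0 fs i)) ->
  (forall i, (i < size fs)%N -> forall y, a i (nth 0 fs i * y) -> a i y) ->
  ~ a (size fs) 1 ->
  a 0%N (mono_sum fs c) ->
  forall l, size l = size fs -> all (fun j => j < M)%N l -> c l = 0.
Proof.
elim: fs a c => [|f fs IH] a c aid amono af areg a1 /= ac.
  case=> // _ _; apply: contrapT => /eqP c0; apply: a1.
  have [_ _ aM] := aid 0%N isT; have := aM (iota (c [::])^-1) _ ac.
  by rewrite -rmorphM mulVf // rmorph1.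
(* The number of powers of [f] is freed from [M], because each division by [f] shortens the sum by
   one. *)
suff ind n (g : nat -> seq nat -> k) :
    a 0%N (\sum_(j < n) f ^+ j * mono_sum fs (g j)) ->
    forall j l, (j < n)%N -> size l = size fs -> all (fun j => j < M)%N l ->
    g j l = 0.
  case=> // j l [szl] /= /andP[ltj ltl].
  exact: (ind M (fun j l => c (j :: l)) ac).
have IHf := IH (fun i => a i.+1).
elim: n g => // n IHn g; have [a0 aD aM] := aid 0%N isT.
rewrite big_ord_recl expr0 mul1r /=.
set s := \sum_(i < n) _; have sE : s = f * \sum_(i < n) f ^+ i *
    mono_sum fs (g i.+1).
  by rewrite mulr_sumr; apply: eq_bigr => i _; rewrite /bump /= add1n exprS mulrA.
move=> as_; have g0 l : size l = size fs -> all (fun j => j < M)%N l -> g 0%N l = 0.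
  apply: IHf => [i hi|i hi|i hi|i hi||].
  - exact: aid.
  - exact: amono.
  - exact: (af i.+1).
  - exact: (areg i.+1).
  - exact: a1.
  - rewrite -[mono_sum _ _](addrK s); apply: idealB; first exact: (aid 1%N).
      exact: amono as_.
    have [_ _ aM1] := aid 1%N isT; rewrite sE mulrC; apply: aM1.
    exact: (af 0%N).
case=> [|j] l ltj; first exact: g0.
apply: (IHn (fun j => g j.+1)) => //.
apply: (areg 0%N isT); rewrite /= -sE.
by move: as_; rewrite mono_sum0 ?add0r.
Qed.

End MonomialSums.

Lemma mono_sum_morph (k : fieldType) (R S : comNzRingType)
    (iota : {rmorphism k -> R}) (iota' : {rmorphism k -> S})
    (rho : {rmorphism R -> S}) M fs c :
  (forall x, rho (iota x) = iota' x) ->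
  rho (mono_sum iota M fs c) = mono_sum iota' M (map rho fs) c.
Proof.
move=> rhoi; elim: fs c => [|f fs IH] c //=.
by rewrite rmorph_sum; apply: eq_bigr => j _; rewrite rmorphM rmorphXn IH.
Qed.

Section DegreeBound.
Variables (k : fieldType) (d : nat).
Implicit Types p q : {mpoly k[d]}.

(** [msize] is one more than the degree, and zero at the zero polynomial. *)
Definition deg_le e p := (msize p <= e.+1)%N.

Lemma deg_leM e e' p q : deg_le e p -> deg_le e' q -> deg_le (e + e') (p * q).
Proof.
rewrite /deg_le; have [->|p0] := eqVneq p 0; first by rewrite mul0r msize0.
have [->|q0] := eqVneq q 0; first by rewrite mulr0 msize0.
rewrite msizeM //; have aux (a b : nat) : (a <= e.+1 -> b <= e'.+1 ->
  (a + b).-1 <= (e + e').+1)%N by lia.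
exact: aux.
Qed.

Lemma deg_leX e p j : deg_le e p -> deg_le (e * j) (p ^+ j).
Proof.
move=> hp; elim: j => [|j IH]; first by rewrite expr0 /deg_le msize1.
by rewrite exprS mulnS; apply: deg_leM.
Qed.

Lemma deg_le_mono e e' p : (e <= e')%N -> deg_le e p -> deg_le e' p.
Proof. by rewrite /deg_le => lee /leq_trans; apply. Qed.

Lemma deg_le_mono_sum M e fs c : all (deg_le e) fs ->
  deg_le (size fs * (M * e)) (mono_sum (@mpolyC d k) M fs c).
Proof.
elim: fs c => [|f fs IH] c /=; first by rewrite /deg_le msizeC leq_b1.
case/andP=> hf hfs; rewrite /deg_le (leq_trans (msize_sum _ _ _)) //.
apply/bigmax_leqP => j _; rewrite mulSn; apply: deg_leM; last exact: IH.
by apply: deg_le_mono (deg_leX j hf); rewrite mulnC leq_mul2r ltnW ?orbT.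
Qed.

Lemma card_bmultinom_le L : (#|{: 'X_{1..d < L.+1}}| <= L.+1 ^ d)%N.
Proof.
have <- : #|{ffun 'I_d -> 'I_L.+1}| = (L.+1 ^ d)%N by rewrite card_ffun !card_ord.
pose h (m : 'X_{1..d < L.+1}) : {ffun 'I_d -> 'I_L.+1} :=
  [ffun i => inord (bmnm m i)].
apply: (@leq_card _ _ h) => m m' /ffunP hm; apply/val_inj/mnmP => i.
have lt (m1 : 'X_{1..d < L.+1}) : (bmnm m1 i < L.+1)%N.
  rewrite (leq_ltn_trans _ (bmdeg m1)) // mdegE (bigD1 i) //= leq_addr //.
by have := congr1 val (hm i); rewrite !ffunE /= !inordK.
Qed.

End DegreeBound.

Lemma lin_dep (k : fieldType) (T U : finType) (a : T -> U -> k) :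
  (#|U| < #|T|)%N ->
  exists2 u : T -> k, (exists t, u t != 0) & forall x, \sum_t u t * a t x = 0.
Proof.
move=> ltUT; pose A := \matrix_(i < #|T|, j < #|U|) a (enum_val i) (enum_val j).
have : kermx A != 0.
  rewrite kermx_eq0 /row_free neq_ltn (leq_ltn_trans _ ltUT) //.
  exact: rank_leq_col.
case/rowV0Pn => v /sub_kermxP vA /rV0Pn[i vi].
exists (fun t => v 0 (enum_rank t)) => [|x].
  by exists (enum_val i); rewrite enum_valK.
have := congr1 (fun B : 'rV_ _ => B 0 (enum_rank x)) vA; rewrite !mxE => vAx.
rewrite -[RHS]vAx.
rewrite [RHS](reindex (@enum_rank T)) /=; last exact/onW_bij/enum_rank_bij.
by apply: eq_bigr => t _; rewrite !mxE !enum_rankK.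
Qed.

(* Were d < m, the M ^ m monomials in the f i with exponents below M would be *)
(* independent, while by their degrees they live in a space whose dimension   *)
(* is only O(M ^ d).                                                          *)
Lemma regular_chain_bound (k : fieldType) (R : comNzRingType)
    (iota : {rmorphism k -> R}) (d : nat) (L : finType)
    (rho : L -> {rmorphism R -> {mpoly k[d]}})
    (a : nat -> R -> Prop) (fs : seq R) :
  (forall l c, rho l (iota c) = c%:MP) ->
  (forall x, (forall l, rho l x = 0) -> x = 0) ->
  (forall i, (i <= size fs)%N -> is_ideal (a i)) ->
  (forall i, (i < size fs)%N -> forall x, a i x -> a i.+1 x) ->
  (forall i, (i < size fs)%N -> a i.+1 (nth 0 fs i)) ->
  (forall i, (i < size fs)%N -> forall y, a i (nth 0 fs i * y) -> a i y) ->
  ~ a (size fs) 1 -> (size fs <= d)%N.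
Proof.
move=> rhoi rho_inj aid amono af areg a1; rewrite leqNgt; apply/negP => ltd.
pose e := (\max_(f <- fs) \max_l msize (rho l f))%N.
have rho_e l : all (deg_le e) (map (rho l) fs).
  rewrite all_map; apply/allP => f ffs /=; rewrite /deg_le leqW //.
  apply: (@leq_trans (\max_l' msize (rho l' f))).
    exact: (leq_bigmax (F := fun l' => msize (rho l' f))).
  exact: (leq_bigmax_seq (F := fun g => \max_l' msize (rho l' g))%N).
(* The degrees are at most D = m M e, so all the images live in dimension at most #|L| (D+1)^d,
   which is at most #|L| (m e + 1)^d M^d. This [M] makes that smaller than M^(d+1), hence than the
   number M^m of monomials. *)
pose m := size fs; pose M := (#|L| * (m * e).+1 ^ d).+1.
pose D := (m * (M * e))%N.
pose delta (t : m.-tuple 'I_M) (l : seq nat) : k := (map val t == l)%:R.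
pose coef (t : m.-tuple 'I_M) (x : L * 'X_{1..d < D.+1}) :=
  (mono_sum (@mpolyC d k) M (map (rho x.1) fs) (delta t))@_(x.2).
have [|u [t0 ut0] hu] := lin_dep coef.
  rewrite card_prod card_tuple card_ord.
  have leD : (D.+1 <= M * (m * e).+1)%N by rewrite /D mulnS mulnCA; lia.
  apply: (@leq_ltn_trans (#|L| * D.+1 ^ d)).
    by rewrite leq_mul2l card_bmultinom_le orbT.
  have leDX : (D.+1 ^ d <= (M * (m * e).+1) ^ d)%N.
    by elim: (d) => // j IH; rewrite !expnS leq_mul.
  apply: (@leq_ltn_trans (#|L| * (M * (m * e).+1) ^ d)).
    by rewrite leq_mul2l leDX orbT.
  apply: (@leq_trans (M ^ d.+1)); last exact: leq_pexp2l.
  by rewrite expnMn mulnCA expnSr ltn_mul2l expn_gt0 /= leqnn.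
case/eqP: ut0.
pose c l := \sum_t u t * delta t l.
have <- : c (map val t0) = u t0.
  rewrite /c (bigD1 t0) //= /delta eqxx mulr1 big1 ?addr0 // => t tt0.
  case: eqP => [/(inj_map val_inj) /val_inj tE|_]; last by rewrite mulr0.
  by rewrite tE eqxx in tt0.
apply: (mono_sum_indep (iota := iota) (M := M) aid amono af areg a1).
- have [a0 _ _] := aid 0%N isT.
  suff -> : mono_sum iota M fs c = 0 by [].
  apply: rho_inj => l; rewrite (mono_sum_morph (iota' := @mpolyC d k)) //.
  apply/mpolyP => x; rewrite mcoeff0.
  have [ltx|gex] := ltnP (mdeg x) D.+1; last first.
    apply: memN_msupp_eq0; apply: msize_mdeg_ge; apply: leq_trans gex.
    by have := deg_le_mono_sum M c (rho_e l); rewrite /deg_le size_map.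
  rewrite mono_sum_lin raddf_sum /= -[RHS](hu (l, BMultinom ltx)).
  by apply: eq_bigr => t _; rewrite mcoeffCM.
- by rewrite size_map; apply: size_tuple.
- by apply/allP => _ /mapP[j _ ->]; apply: ltn_ord.
Qed.

(** * Koszul complexes *)

Section Koszul.
Variable R : comNzRingType.
Implicit Types (z w : seq R) (u v : seq bool -> R) (s t : seq bool).

(* The Koszul complex of z: a list s of booleans of the size of z stands for  *)
(* the exterior product of the basis vectors selected by s, and u for the     *)
(* combination of these with coefficients u s.                                *)
Fixpoint kosz z u s : R :=
  match z, s with
  | a :: z', false :: s' =>
      kosz z' (fun t => u (false :: t)) s' + a * u (true :: s')
  | _ :: z', true :: s' => - kosz z' (fun t => u (true :: t)) s'
  | _, _ => 0
  end.

(* Left exterior multiplication by the vector with coordinates w. *)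
Fixpoint wedge w u s : R :=
  match w, s with
  | _ :: w', false :: s' => wedge w' (fun t => u (false :: t)) s'
  | a :: w', true :: s' =>
      a * u (false :: s') - wedge w' (fun t => u (true :: t)) s'
  | _, _ => 0
  end.

Definition ndeg s := count id s.

Lemma kosz_ext_deg z u v s : size s = size z ->
  (forall t, size t = size z -> ndeg t = (ndeg s).+1 -> u t = v t) ->
  kosz z u s = kosz z v s.
Proof.
elim: z u v s => [|a z IH] u v [|[] s] //= [sz] uv.
  by congr (- _); apply: IH => // t szt nt; apply: uv; rewrite /= ?szt ?nt.
congr (_ + _ * _); last by apply: uv; rewrite /= ?sz.
by apply: IH => // t szt nt; apply: uv; rewrite /= ?szt ?nt.
Qed.

Lemma kosz_ext z u v s : size s = size z ->
  (forall t, size t = size z -> u t = v t) -> kosz z u s = kosz z v s.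
Proof. by move=> sz uv; apply: kosz_ext_deg => // t szt _; apply: uv. Qed.

Lemma koszP z c u v s :
  kosz z (fun t => u t + c * v t) s = kosz z u s + c * kosz z v s.
Proof.
elim: z u v s => [|a z IH] u v [|[] s] /=; try by rewrite mulr0 addr0.
  by rewrite IH; ring.
by rewrite IH; ring.
Qed.

Lemma kosz0 z s : kosz z (fun=> 0) s = 0.
Proof.
elim: z s => [|a z IH] [|[] s] //=; rewrite IH ?oppr0 //.
by rewrite mulr0 addr0.
Qed.

Lemma koszB z u v s : kosz z (fun t => u t - v t) s = kosz z u s - kosz z v s.
Proof.
rewrite -[in RHS]mulN1r -koszP; congr (kosz z _ s).
by apply/funext => t; rewrite mulN1r.
Qed.

Lemma koszN z u s : kosz z (fun t => - u t) s = - kosz z u s.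
Proof.
rewrite -[RHS]add0r -(kosz0 z s) -koszB; congr (kosz z _ s).
by apply/funext => t; rewrite add0r.
Qed.

Lemma kosz_sum z (T : finType) (c : T -> R) (u : T -> seq bool -> R) s :
  kosz z (fun t => \sum_x c x * u x t) s = \sum_x c x * kosz z (u x) s.
Proof.
elim: z u s => [|a z IH] u [|[] s] /=; try by rewrite big1 // => x; rewrite mulr0.
  by rewrite IH -sumrN; apply: eq_bigr => x _; rewrite mulrN.
rewrite IH mulr_sumr -big_split; apply: eq_bigr => x _ /=; ring.
Qed.

Lemma kosz_kosz z u s : kosz z (kosz z u) s = 0.
Proof.
elim: z u s => [|a z IH] u [|[] s] //=; first by rewrite koszN IH !oppr0.
by rewrite koszP IH mulrN add0r subrr.
Qed.

Lemma kosz_closed (Q : R -> Prop) z u s :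
  Q 0 -> (forall x y, Q x -> Q y -> Q (x + y)) -> (forall x, Q x -> Q (- x)) ->
  size s = size z ->
  (forall a t, a \in z -> size t = size z -> Q (a * u t)) -> Q (kosz z u s).
Proof.
move=> Q0 QD QN; elim: z u s => [|a z IH] u [|[] s] //= [sz] Qz.
  apply/QN/IH => // b t bz szt.
  by apply: Qz; rewrite /= ?szt // inE bz orbT.
apply: QD; last by apply: Qz; rewrite /= ?sz // inE eqxx.
apply: IH => // b t bz szt.
by apply: Qz; rewrite /= ?szt // inE bz orbT.
Qed.

Lemma kosz_ideal J z u s : is_ideal J -> size s = size z ->
  (forall t, size t = size z -> J (u t)) -> J (kosz z u s).
Proof.
move=> Jid sz Ju; have [J0 JD JM] := Jid.
apply: kosz_closed => // [x|a t _ /Ju]; [exact: idealN | exact: JM].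
Qed.

Lemma koszZ z c u s : kosz z (fun t => c * u t) s = c * kosz z u s.
Proof.
rewrite -[RHS]add0r -(kosz0 z s) -koszP; congr (kosz z _ s).
by apply/funext => t; rewrite add0r.
Qed.

Lemma wedgeP w c u v s :
  wedge w (fun t => u t + c * v t) s = wedge w u s + c * wedge w v s.
Proof.
elim: w u v s => [|a w IH] u v [|[] s] /=; try by rewrite mulr0 addr0.
  by rewrite IH; ring.
by rewrite IH.
Qed.

Lemma wedge0 w s : wedge w (fun=> 0) s = 0.
Proof.
by elim: w s => [|a w IH] [|[] s] //=; rewrite IH // mulr0 subrr.
Qed.

Lemma wedgeN w u s : wedge w (fun t => - u t) s = - wedge w u s.
Proof.
rewrite -[RHS]add0r -(wedge0 w s) -mulN1r -wedgeP; congr (wedge w _ s).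
by apply/funext => t; rewrite add0r mulN1r.
Qed.

Definition dotp z w := \sum_(i < size z) nth 0 z i * nth 0 w i.

(** Contraction is an antiderivation of the exterior algebra. Consequently the product of [w] with a
    cycle [u] is again a cycle once [dotp z w] kills [u]. *)
Lemma wedge_leibniz z w u s : size w = size z -> size s = size z ->
  kosz z (wedge w u) s + wedge w (kosz z u) s = dotp z w * u s.
Proof.
have dotp_cons a b z' w' : dotp (a :: z') (b :: w') = a * b + dotp z' w'.
  by rewrite /dotp big_ord_recl.
elim: z w u s => [|a z IH] [|b w] u [|[] s] //=.
- by move=> _ _; rewrite /dotp big_ord0 addr0 mul0r.
- move=> [szw] [szs]; rewrite dotp_cons mulrDl.
  by rewrite -(IH w (fun t => u (true :: t)) s) // koszB koszZ wedgeN; ring.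
- move=> [szw] [szs]; rewrite dotp_cons mulrDl.
  by rewrite -(IH w (fun t => u (false :: t)) s) // wedgeP; ring.
Qed.

(* Killing an element regular modulo J does not change the homology of the    *)
(* Koszul complex modulo J.                                                   *)
Lemma kosz_reduce J (ts xs : seq R) u : is_ideal J -> regular_mod J ts ->
  (forall s, size s = size (ts ++ xs) -> J (kosz (ts ++ xs) u s)) ->
  (exists v, forall s, size s = size xs ->
     ideal_adds J ts (u (nseq (size ts) false ++ s) - kosz xs v s)) ->
  exists v, forall s, size s = size (ts ++ xs) ->
    J (u s - kosz (ts ++ xs) v s).
Proof.
elim: ts J u => [|th ts IH] J u Jid //.
rewrite cat_cons [size (th :: _)]/= -/(ideal_adds _ _) [ideal_adds _ (th :: _)]/=.
move=> /regular_mod_cons[regth reg] Ju uw.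
have [J0 JD JM] := Jid; have J1id := ideal_add_ideal th Jid.
(* The part of [u] without the first basis vector is a cycle modulo [J] and [th], so induction
   bounds it there. *)
have [|w0 hw0] := IH _ (fun s => u (false :: s)) J1id reg _ uw.
  move=> s sz; exists (kosz (th :: ts ++ xs) u (false :: s)).
    by apply: Ju; rewrite /= sz.
  by exists (- u (true :: s)) => /=; ring.
(* The error left modulo [J] is a multiple of [th]; its cofactor [b] serves as the part of the
   primitive [W] that contains the first basis vector. *)
have /choice[b hb] : forall s, exists b, size s = size (ts ++ xs) ->
    J (u (false :: s) - kosz (ts ++ xs) w0 s - b * th).
  move=> s; have [sz|nsz] := pselect (size s = size (ts ++ xs)).
    by have [y Jy [b yE]] := hw0 s sz; exists b => _; rewrite yE addrK.
  by exists 0 => sz.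
pose W s := match s with
  | false :: s' => w0 s' | true :: s' => b s' | [::] => 0 end.
have Wf s : size s = size (ts ++ xs) ->
    J (u (false :: s) - kosz (th :: ts ++ xs) W (false :: s)).
  by move=> sz; rewrite /= opprD addrA [th * _]mulrC; apply: hb.
exists W => -[|[] s] //= [sz]; last exact: Wf.
(* The difference [v] is a cycle modulo [J] whose part without the first vector is in [J]. Its
   differential thus leaves [th] times the remaining part in [J], and [th] is regular. *)
apply: regth; set v := fun s => u s - kosz (th :: ts ++ xs) W s.
have : J (kosz (th :: ts ++ xs) v (false :: s)).
  by rewrite koszB kosz_kosz subr0; apply: Ju; rewrite /= sz.
rewrite /= => Jv; have := idealB Jid Jv (kosz_ideal Jid sz Wf).
by rewrite addrAC subrr add0r.
Qed.

Lemma kosz_head J (ts xs : seq R) u s : is_ideal J -> size s = size xs ->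
  ideal_adds J ts (kosz (ts ++ xs) u (nseq (size ts) false ++ s) -
    kosz xs (fun t => u (nseq (size ts) false ++ t)) s).
Proof.
move=> Jid sz; elim: ts J u Jid => [|a ts IH] J u Jid /=.
  by rewrite subrr; case: Jid.
have J1id := ideal_add_ideal a Jid.
rewrite addrAC; have [_ JD _] := ideal_adds_ideal ts J1id.
apply: JD; first exact: (IH _ (fun t => u (false :: t))).
by apply: ideal_addsl; rewrite mulrC; apply: ideal_addr.
Qed.

Lemma ndeg_le s : (ndeg s <= size s)%N.
Proof. exact: count_size. Qed.

Lemma ndeg_full s : ndeg s = size s -> s = nseq (size s) true.
Proof. by move=> /eqP; rewrite -all_count; elim: s => [|[] s IH] //= /IH{1}->. Qed.

Lemma kosz_top z u s : size s = size z -> ndeg s = size z -> kosz z u s = 0.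
Proof.
move=> sz ns; rewrite -(kosz0 z s); apply: kosz_ext_deg => // t szt.
by rewrite ns => nt; have := ndeg_le t; rewrite nt szt ltnn.
Qed.

(** Take for [s] the sequence omitting only position [i]. For a top-degree cycle this says that each
    [z_i] kills the top coefficient, which is how the socle appears. *)
Lemma kosz_corner z u i : (i < size z)%N ->
  (forall t, size t = size z -> ndeg t <> size z -> u t = 0) ->
  exists2 s, size s = size z &
    kosz z u s = nth 0 z i * u (nseq (size z) true) \/
    kosz z u s = - (nth 0 z i * u (nseq (size z) true)).
Proof.
elim: z u i => // a z IH u [|i] /= lti u0.
  exists (false :: nseq (size z) true); rewrite /= ?size_nseq //; left.
  rewrite kosz_top ?add0r ?size_nseq //.
  by rewrite /ndeg count_nseq /= mul1n.
have [||s sz us] := IH (fun t => u (true :: t)) i; first exact: lti.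
  by move=> t szt nt; apply: u0; rewrite /= ?szt // add1n => -[].
exists (true :: s); rewrite /= ?sz //.
by case: us => ->; [right | left]; rewrite ?opprK.
Qed.

Lemma wedge_ext_deg w u v s : size s = size w ->
  (forall t, size t = size w -> (ndeg t).+1 = ndeg s -> u t = v t) ->
  wedge w u s = wedge w v s.
Proof.
elim: w u v s => [|a w IH] u v [|[] s] //= [sz] uv.
  congr (_ * _ - _); first by apply: uv; rewrite /= ?sz.
  by apply: IH => // t szt nt; apply: uv; rewrite /= ?szt ?add1n ?nt.
by apply: IH => // t szt nt; apply: uv; rewrite /= ?szt ?nt.
Qed.

Lemma wedge_closed (Q : R -> Prop) w u s :
  Q 0 -> (forall x y, Q x -> Q y -> Q (x + y)) -> (forall x, Q x -> Q (- x)) ->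
  size s = size w ->
  (forall a t, a \in w -> size t = size w -> Q (a * u t)) -> Q (wedge w u s).
Proof.
move=> Q0 QD QN; elim: w u s => [|a w IH] u [|[] s] //= [sz] Qw.
  apply: QD; first by apply: Qw; rewrite /= ?sz // inE eqxx.
  by apply/QN/IH => // b t bw szt; apply: Qw; rewrite /= ?szt // inE bw orbT.
by apply: IH => // b t bw szt; apply: Qw; rewrite /= ?szt // inE bw orbT.
Qed.

Lemma wedge_head w w' u s :
  wedge (w ++ w') u (nseq (size w) false ++ s) =
  wedge w' (fun t => u (nseq (size w) false ++ t)) s.
Proof. by elim: w u => [|a w IH] u //=; apply: IH. Qed.

Lemma wedge_nseq0 m u s : wedge (nseq m 0) u s = 0.
Proof.
by elim: m u s => [|m IH] u [|[] s] //=; rewrite !IH mul0r subrr.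
Qed.

Lemma wedge_units m (u : seq bool -> R) :
  foldr (fun a v => wedge [seq (b == a)%:R | b <- iota 0 m] v) u (iota 0 m)
    (nseq m true) = u (nseq m false).
Proof.
elim: m u => [|m IH] u //.
have -> : iota 0 m.+1 = 0%N :: [seq i.+1 | i <- iota 0 m].
  by rewrite /= -(iotaDl 1 0).
pose f a (v : seq bool -> R) :=
  wedge [seq (b == a)%:R | b <- 0%N :: [seq i.+1 | i <- iota 0 m]] v.
have f0 v t : f 0%N v (true :: t) = v (false :: t).
  rewrite /f /= mul1r -map_comp (eq_map (g := fun=> 0)) //.
  have -> : [seq 0 | _ <- iota 0 m] = nseq m 0 :> seq R.
    by rewrite -[in RHS](size_iota 0 m); elim: (iota 0 m) => //= _ l ->.
  by rewrite wedge_nseq0 subr0.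
have fS a v t : f a.+1 v (false :: t) =
    wedge [seq (b == a)%:R | b <- iota 0 m] (fun t => v (false :: t)) t.
  by rewrite /f /= -map_comp (eq_map (g := fun b => (b == a)%:R)).
rewrite -[LHS]/(f 0%N (foldr f u [seq i.+1 | i <- iota 0 m]) (true :: nseq m true)).
rewrite f0 foldr_map -[RHS](IH (fun t => u (false :: t))).
elim: {-2}(iota 0 m) (nseq m true) => [//|a l IHl] t.
rewrite [LHS]fS; congr (wedge _ _ _); apply/funext => t'; exact: IHl.
Qed.

Lemma dotp_cat z z' w w' : size z = size w ->
  dotp (z ++ z') (w ++ w') = dotp z w + dotp z' w'.
Proof.
move=> sz; rewrite /dotp size_cat big_split_ord; congr (_ + _).
  by apply: eq_bigr => i _; rewrite !nth_cat -sz /= ltn_ord.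
by apply: eq_bigr => i _; rewrite !nth_cat -sz /= ltnNge leq_addr /= addKn.
Qed.

Lemma dotp_map m (f g : 'I_m -> R) :
  dotp [seq f i | i <- enum 'I_m] [seq g i | i <- enum 'I_m] = \sum_i f i * g i.
Proof.
rewrite /dotp (size_map f) size_enum_ord; apply: eq_bigr => i _.
by rewrite (nth_map i 0 f) ?(nth_map i 0 g) ?size_enum_ord // nth_ord_enum.
Qed.

End Koszul.

Lemma kosz_morph (R Q : comNzRingType) (phi : {rmorphism R -> Q}) z u s :
  phi (kosz z u s) = kosz (map phi z) (phi \o u) s.
Proof.
elim: z u s => [|a z IH] u [|[] s] //=; rewrite ?rmorph0 //.
  by rewrite rmorphN IH.
by rewrite rmorphD rmorphM IH.
Qed.

(** * The Koszul resolution of the residue field *)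

Section KoszulResolution.
Variables (k : fieldType) (n : nat).
Local Notation S := {mpoly k[n]}.
Variable z : n.-tuple S.

Definition kos_basis i : finType := {s : n.-tuple bool | ndeg s == i}.

Definition kos_diff (R : comNzRingType) (y : seq R) i
    (a : kos_basis i.+1) (b : kos_basis i) : R :=
  kosz y (fun t => (t == val (val a))%:R) (val (val b)).

(** Extension by zero of a chain of degree [i] to all boolean sequences, the form on which [kosz]
    and [wedge] act. *)
Definition kos_ext (R : comNzRingType) i (v : {ffun kos_basis i -> R})
  (s : seq bool) : R := \sum_a v a * (s == val (val a))%:R.

Lemma kos_extE (R : comNzRingType) i (v : {ffun kos_basis i -> R}) b :
  kos_ext v (val (val b)) = v b.
Proof.
rewrite /kos_ext (bigD1 b) //= eqxx mulr1 big1 ?addr0 // => a ab.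
case: eqP => [/val_inj/val_inj E|_]; last by rewrite mulr0.
by rewrite E eqxx in ab.
Qed.

Lemma kos_ext_deg (R : comNzRingType) i (v : {ffun kos_basis i -> R}) s :
  ndeg s <> i -> kos_ext v s = 0.
Proof.
move=> si; rewrite /kos_ext big1 // => a _.
case: eqP => [E|_]; last by rewrite mulr0.
by case: si; rewrite E; apply/eqP/(valP a).
Qed.

Lemma kos_basisP i (s : seq bool) : size s = n -> ndeg s = i ->
  exists b : kos_basis i, val (val b) = s.
Proof.
move=> /eqP sz /eqP si.
by exists (Sub (Tuple sz : n.-tuple bool) (si : ndeg (Tuple sz) == i)).
Qed.

Lemma free_map_kos (R : comNzRingType) (y : seq R) i
    (v : {ffun kos_basis i.+1 -> R}) b :
  free_map (@kos_diff R y i) v b = kosz y (kos_ext v) (val (val b)).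
Proof.
by rewrite ffunE [RHS](kosz_sum y v (fun x t => (t == val (val x))%:R)).
Qed.

Lemma kos_ext_free_map (R : comNzRingType) (y : seq R) i
    (v : {ffun kos_basis i.+1 -> R}) s : size y = n -> size s = n ->
  kos_ext (free_map (@kos_diff R y i) v) s = kosz y (kos_ext v) s.
Proof.
move=> szy szs; have [si|si] := eqVneq (ndeg s) i.
  by have [b <-] := kos_basisP szs si; rewrite kos_extE free_map_kos.
rewrite kos_ext_deg; last exact/eqP.
rewrite -(kosz0 y s); apply: kosz_ext_deg; first by rewrite szy.
move=> t _ nt; rewrite kos_ext_deg // nt => -[] /eqP; exact/negP.
Qed.

Lemma free_map_kos_restrict (R : comNzRingType) (y : seq R) i
    (w : seq bool -> R) b : size y = n ->
  free_map (@kos_diff R y i) [ffun a => w (val (val a))] b =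
  kosz y w (val (val b)).
Proof.
move=> szy; rewrite free_map_kos; apply: kosz_ext_deg.
  by rewrite szy size_tuple.
move=> t szt; rewrite (eqP (valP b)) => nt.
rewrite szy in szt; have [a <-] := kos_basisP szt nt.
by rewrite kos_extE ffunE.
Qed.

Lemma kos_boundary (R : comNzRingType) (ts xs : seq R) i
    (v : {ffun kos_basis i -> R}) :
  size (ts ++ xs) = n -> regular_mod (@zero_ideal R) ts ->
  (forall s, size s = n -> kosz (ts ++ xs) (kos_ext v) s = 0) ->
  (exists w, forall s, size s = size xs -> ideal_adds (@zero_ideal R) ts
     (kos_ext v (nseq (size ts) false ++ s) - kosz xs w s)) ->
  exists w, v = free_map (@kos_diff R (ts ++ xs) i) w.
Proof.
move=> szn reg dv v0; have [|W hW] := kosz_reduce (@zero_ideal_ideal R) reg _ v0.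
  by move=> s; rewrite szn => /dv.
exists [ffun a => W (val (val a))]; apply/ffunP => b.
rewrite free_map_kos_restrict // -kos_extE.
have := hW (val (val b)); rewrite szn size_tuple => /(_ erefl)/eqP.
by rewrite subr_eq0 => /eqP.
Qed.

Hypothesis z_homog : forall a, a \in z -> a \is 1.-homog.
Hypothesis z_regular : regular_mod (@zero_ideal _) z.
Hypothesis z_gen : forall p : S,
  p.@[fun=> 0] = 0 -> ideal_adds (@zero_ideal _) z p.

Let d := @kos_diff _ (z : seq S).

Lemma kos_homog i (a : kos_basis i.+1) (b : kos_basis i) : d a b = 0 \/
  exists2 e, (e + i = i.+1)%N & d a b \is e.-homog.
Proof.
right; exists 1%N; rewrite ?add1n //.
apply: (@kosz_closed _ (fun p => p \is 1.-homog)) => [|x y|x||c t cz szt].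
- exact: dhomog0.
- exact: rpredD.
- by rewrite dhomogN.
- by rewrite !size_tuple.
- case: eqP => _; rewrite ?mulr1 ?mulr0 ?dhomog0 //; exact: z_homog.
Qed.

Definition kos_aug (b : kos_basis 0) : k := 1.

Lemma kos_basis0 : exists b : kos_basis 0, forall b', b' = b.
Proof.
have [||b hb] := @kos_basisP 0 (nseq n false).
- exact: size_nseq.
- by rewrite /ndeg count_nseq.
exists b => b'; apply/val_inj/val_inj; rewrite hb.
have nd0 s : ndeg s = 0%N -> s = nseq (size s) false.
  by elim: s => [|[] s IH] //= /IH{1}->.
by rewrite [LHS](nd0 _ (eqP (valP b'))) size_tuple.
Qed.

Lemma kos_aug_surj c : exists v : {ffun kos_basis 0 -> S},
  \sum_b (v b).@[fun=> 0] * kos_aug b = c.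
Proof.
have [b hb] := kos_basis0; exists [ffun=> c%:MP].
rewrite (bigD1 b) //= big1 ?ffunE ?mevalC ?mulr1 ?addr0 // => b'.
by rewrite (hb b') eqxx.
Qed.

(** With all of [z] killed, only the coefficient of the empty exterior product survives: it is zero
    in positive degree, and in degree 0 it is what the augmentation tests. *)
Lemma kos_exact_lift i (v : {ffun kos_basis i -> S}) :
  (forall s, size s = n -> kosz z (kos_ext v) s = 0) ->
  ideal_adds (@zero_ideal _) z (kos_ext v (nseq n false)) ->
  exists w, v = free_map (@d i) w.
Proof.
move=> dv v0; have := @kos_boundary S z [::] i v; rewrite cats0.
apply=> //; first exact: size_tuple.
by exists (fun=> 0) => -[] // _; rewrite cats0 size_tuple kosz0 subr0.
Qed.

Lemma kos_exact0 (v : {ffun kos_basis 0 -> S}) :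
  \sum_b (v b).@[fun=> 0] * kos_aug b = 0 <-> exists w, v = free_map (@d 0) w.
Proof.
have [b hb] := kos_basis0.
have -> : \sum_b (v b).@[fun=> 0] * kos_aug b = (v b).@[fun=> 0].
  by rewrite (bigD1 b) //= big1 ?mulr1 ?addr0 // => b'; rewrite (hb b') eqxx.
split=> [v0|[w ->]].
  apply: kos_exact_lift => [s szs|].
    rewrite -(kosz0 z s); apply: kosz_ext_deg => [|t _ nt].
      by rewrite size_tuple.
    by rewrite kos_ext_deg // nt.
  have [c <-] := @kos_basisP 0 (nseq n false) (size_nseq _ _) (count_nseq _ _ _).
  by rewrite kos_extE (hb c); apply: z_gen.
rewrite free_map_kos; apply: (@kosz_closed _ (fun p => p.@[fun=> 0] = 0)).
- exact: meval0.
- by move=> x y; rewrite mevalD => -> ->; rewrite addr0.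
- by move=> x; rewrite mevalN => ->; rewrite oppr0.
- by rewrite !size_tuple.
- move=> a t /z_homog /dhomogP az _; rewrite mevalM.
  suff -> : a.@[fun=> 0] = 0 by rewrite mul0r.
  rewrite mevalE big_seq big1 // => m /az md.
  have : m != 0%MM by rewrite -mdeg_eq0 md.
  rewrite -mdeg_eq0 mdegE => /negP m0.
  have /existsP[i mi] : [exists i, m i != 0%N].
    apply: contra_notT m0 => /existsPn m0; rewrite sum_nat_eq0.
    by apply/forallP => i; move: (m0 i); case: (m i == 0%N).
  by rewrite (bigD1 i) //= expr0n (negPf mi) mul0r mulr0.
Qed.

Lemma kos_exactS i (v : {ffun kos_basis i.+1 -> S}) :
  free_map (@d i) v = 0 <-> exists w, v = free_map (@d i.+1) w.
Proof.
split=> [dv|[w ->]].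
  apply: kos_exact_lift => [s szs|].
    rewrite -kos_ext_free_map ?size_tuple // dv /kos_ext big1 // => a _.
    by rewrite ffunE mul0r.
  rewrite kos_ext_deg; first exact/ideal_addsl.
  by rewrite /ndeg count_nseq.
apply/ffunP => b; rewrite free_map_kos ffunE -[RHS](kosz_kosz z (kos_ext w)
  (val (val b))).
apply: kosz_ext => [|t szt]; first by rewrite !size_tuple.
by rewrite size_tuple in szt; rewrite kos_ext_free_map // size_tuple.
Qed.

(** As the [z] are linear forms, an exterior product of [i] basis vectors sits in degree [i]. *)
Definition koszul_resolution : gr_free_resolution k n :=
  @GrFreeResolution k n kos_basis (fun i _ => i) d kos_aug
    kos_homog (fun _ => or_intror erefl) kos_aug_surj kos_exact0 kos_exactS.

End KoszulResolution.

(** * Residue fields and regular sequences *)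

Section QuotientLift.
Variables (R : comNzRingType) (I : idealr R) (Q : comNzRingType).
Variables (phi : {rmorphism R -> Q}) (phiI : forall x, x \in I -> phi x = 0).

Definition quot_lift (_ : forall x, x \in I -> phi x = 0)
  (r : {ideal_quot I}) : Q := phi (repr r).

Lemma quot_liftE x : quot_lift phiI (\pi_({ideal_quot I}) x) = phi x.
Proof.
apply/eqP; rewrite -subr_eq0 -rmorphB phiI //.
by rewrite Quotient.idealrBE reprK.
Qed.

Lemma quot_lift_zmod_morphism : zmod_morphism (quot_lift phiI).
Proof.
move=> x y; rewrite -[x]reprK -[y]reprK -rmorphB !quot_liftE; exact: rmorphB.
Qed.

Lemma quot_lift_monoid_morphism : monoid_morphism (quot_lift phiI).
Proof.
split=> [|x y]; first by rewrite -(rmorph1 (\pi_({ideal_quot I}))) quot_liftE rmorph1.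
rewrite -[x]reprK -[y]reprK -rmorphM !quot_liftE; exact: rmorphM.
Qed.

HB.instance Definition _ := GRing.isZmodMorphism.Build _ _ (quot_lift phiI)
  quot_lift_zmod_morphism.
HB.instance Definition _ := GRing.isMonoidMorphism.Build _ _ (quot_lift phiI)
  quot_lift_monoid_morphism.

End QuotientLift.

Section ResidueField.
Variables (R : comNzRingType) (P : R -> Prop).

Definition max_pred (_ : is_maximal P) : {pred R} := fun x => `[< P x >].

Hypothesis Pmax : is_maximal P.

Lemma max_pred_closed : idealr_closed (max_pred Pmax).
Proof.
have [[P0 PD PM] P1 _] := Pmax; split.
- exact/asboolP.
- by apply/negP => /asboolP.
- by move=> a u v /asboolP Pu /asboolP Pv; apply/asboolP/PD => //; apply: PM.
Qed.

HB.instance Definition _ := isIdealr.Build R (max_pred Pmax) max_pred_closed.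

Definition residue_field := {ideal_quot (max_pred Pmax)}.
HB.instance Definition _ := GRing.ComNzRing.on residue_field.

Definition residue (x : R) : residue_field := \pi_({ideal_quot (max_pred Pmax)}) x.

Lemma residue_zmod_morphism : zmod_morphism residue.
Proof. by move=> x y; rewrite /residue rmorphB. Qed.

Lemma residue_monoid_morphism : monoid_morphism residue.
Proof. by split=> [|x y]; rewrite /residue ?rmorph1 ?rmorphM. Qed.

HB.instance Definition _ := GRing.isZmodMorphism.Build _ _ residue
  residue_zmod_morphism.
HB.instance Definition _ := GRing.isMonoidMorphism.Build _ _ residue
  residue_monoid_morphism.

Lemma residue_surj z : exists x, residue x = z.
Proof. by exists (repr z); apply: reprK. Qed.

Lemma residue_eq0 x : residue x = 0 <-> P x.
Proof.
have -> : (residue x = 0) <-> (x - 0 \in max_pred Pmax).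
  rewrite Quotient.idealrBE; split=> [xE|/eqP xE].
    by apply/eqP; rewrite [LHS]xE [RHS]rmorph0.
  by rewrite /residue xE [LHS]rmorph0.
by rewrite subr0; split=> /asboolP.
Qed.

Lemma residue_inv (z : residue_field) : z != 0 -> exists y, y * z = 1.
Proof.
have [x <-] := residue_surj z => /eqP x0.
have [Pid P1 Pm] := Pmax.
have [] : ideal_add P x 1.
  apply: contrapT => Px1; apply: x0; apply/residue_eq0.
  apply: (Pm _ (ideal_add_ideal x Pid) Px1 (@ideal_addl _ P x)).
  by have := ideal_addr x 1 Pid; rewrite mul1r.
move=> y /residue_eq0 y0 [b bx]; exists (residue b).
by rewrite -rmorphM -[LHS]add0r -y0 -rmorphD -bx rmorph1.
Qed.

Definition residue_inverse (z : residue_field) : residue_field :=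
  if pselect (z != 0) is left z0 then sval (cid (residue_inv z0)) else 0.

Lemma residue_mulVf z : z != 0 -> residue_inverse z * z = 1.
Proof. by rewrite /residue_inverse; case: pselect => // z0 _; case: cid. Qed.

Lemma residue_invr0 : residue_inverse 0 = 0.
Proof.
rewrite /residue_inverse; case: pselect => // nz.
by exfalso; move: nz; rewrite eqxx.
Qed.

HB.instance Definition _ := GRing.ComNzRing_isField.Build residue_field
  residue_mulVf residue_invr0.

End ResidueField.

Lemma generated_mpoly (k : comNzRingType) n :
  generated (@mpolyC n k) [seq 'X_i | i <- enum 'I_n].
Proof.
move=> Q QC Qv QD QM p; rewrite [p]mpolyE.
have QX i : Q 'X_i by apply/Qv/map_f; rewrite mem_enum.
have Q0 : Q 0 by rewrite -(rmorph0 (@mpolyC n k)); apply: QC.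
have Q1 : Q 1 by rewrite -(rmorph1 (@mpolyC n k)); apply: QC.
have QXn i j : Q ('X_i ^+ j).
  by elim: j => [|j IH]; rewrite ?expr0 // exprS; apply: QM.
apply: (big_ind Q Q0 QD) => m _; rewrite -mul_mpolyC; apply: (QM); first exact: QC.
by rewrite mpolyXE_id; apply: (big_ind Q Q1 QM) => i _; apply: QXn.
Qed.

Lemma generated_image (R S K : comNzRingType) (phi : R -> S)
    (psi : {rmorphism S -> K}) s :
  (forall z, exists x, psi x = z) -> generated phi s ->
  generated (psi \o phi) (map psi s).
Proof.
move=> surj gen Q Qphi Qs QD QM z; have [x <-] := surj z.
apply: (gen (fun x => Q (psi x))) => [a|u us|u v|u v].
- exact: Qphi.
- exact/Qs/map_f.
- by rewrite rmorphD; apply: QD.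
- by rewrite rmorphM; apply: QM.
Qed.

Lemma generated_eq (R S K : nzRingType) (phi : R -> S) s
    (f g : {rmorphism S -> K}) :
  generated phi s -> (forall a, f (phi a) = g (phi a)) ->
  (forall u, u \in s -> f u = g u) -> f =1 g.
Proof.
move=> gen fphi fs z; apply: (gen (fun z => f z = g z)) => // x y fx fy.
  by rewrite !rmorphD fx fy.
by rewrite !rmorphM fx fy.
Qed.

Lemma mpoly_rmorph_eq (k K : comNzRingType) n (f g : {rmorphism {mpoly k[n]} -> K}) :
  (forall c, f c%:MP = g c%:MP) -> (forall i, f 'X_i = g 'X_i) -> f =1 g.
Proof.
move=> fC fX; apply: generated_eq (@generated_mpoly k n) fC _.
by move=> _ /mapP[i _ ->].
Qed.

Section MonicRegular.
Variable R : comNzRingType.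

(** The leading coefficient of [p * q] is that of [p], so it lies in [I]; remove the leading term of
    [p] and induct on its degree. *)
Lemma coef_ideal_monicM (I : R -> Prop) (p q : {poly R}) : is_ideal I ->
  q \is monic -> (forall i, I (p * q)`_i) -> forall i, I p`_i.
Proof.
move=> Iid qm; have [I0 ID IM] := Iid.
have [n] := ubnP (size p); elim: n p => // n IH p; rewrite ltnS => szp Ipq.
have [->|p0] := eqVneq p 0; first by move=> i; rewrite coef0.
have Ilp : I (lead_coef p) by rewrite -(lead_coef_Mmonic p qm); apply: Ipq.
pose m := (size p).-1.
have szpE : size p = m.+1 by rewrite prednK // size_poly_gt0.
pose p' := p - lead_coef p *: 'X^m.
have Ip' : forall i, I p'`_i.
  apply: IH => [|i].
    apply: leq_trans szp; rewrite szpE ltnS; apply/leq_sizeP => j.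
    rewrite leq_eqVlt coefB coefZ coefXn => /orP[/eqP<-|lt_j].
      by rewrite eqxx mulr1 subrr.
    by rewrite nth_default ?szpE // gtn_eqF // mulr0 subrr.
  rewrite mulrBl coefB -scalerAl coefZ; apply: idealB => //.
  by rewrite mulrC; apply: IM.
move=> i; have -> : p`_i = p'`_i + (i == m)%:R * lead_coef p.
  by rewrite coefB coefZ coefXn [lead_coef p * _]mulrC subrK.
by apply: ID; [apply: Ip' | apply: IM].
Qed.

(* Modulo the ideal of the preceding elements, which are constant for phi,    *)
(* the i-th element is a monic polynomial in a new variable.                  *)
Lemma regular_by_subst (s : seq R) :
  (forall i, (i < size s)%N -> exists (phi : {rmorphism R -> {poly R}}) y,
    [/\ forall x, (phi x).[y] = x,
        forall j, (j < i)%N -> phi (nth 0 s j) = (nth 0 s j)%:P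
      & phi (nth 0 s i) \is monic]) ->
  regular_mod (@zero_ideal R) s.
Proof.
move=> sub i lti x sx; have [phi [y [phiK phi_lt phi_monic]]] := sub i lti.
set J := ideal_adds _ _ in sx *.
have Jid : is_ideal J by apply/ideal_adds_ideal/zero_ideal_ideal.
have [J0 JD JM] := Jid.
(* Evaluation at [y] recovers [x] from [phi x], so [x] is a combination of the coefficients of
   [phi x]. *)
suff Jphi : forall j, J (phi x)`_j.
  rewrite -[x]phiK horner_coef; apply: ideal_sum => // j _.
  by rewrite mulrC; apply: JM.
apply: (coef_ideal_monicM Jid phi_monic).
rewrite -rmorphM mulrC; move: sx; set z := _ * x.
apply: (@ideal_adds_min _ _ (fun z => forall j, J (phi z)`_j)).
- split=> [j|u v Ju Jv j|a u Ju j]; first by rewrite rmorph0 coef0.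
    by rewrite rmorphD coefD; apply: JD.
  rewrite rmorphM coefM; apply: ideal_sum => // l _; exact: JM.
- by move=> _ -> j; rewrite rmorph0 coef0.
- move=> a /(nthP 0)[j]; rewrite size_take lti => ltj.
  rewrite nth_take // => <- l; rewrite phi_lt // coefC.
  case: eqP => // _; apply: mem_ideal_adds; first exact: zero_ideal_ideal.
  by rewrite -(nth_take 0 ltj) mem_nth // size_take lti.
Qed.

End MonicRegular.

Lemma mpoly_aug_ideal (k : comNzRingType) n (J : {mpoly k[n]} -> Prop) :
  is_ideal J -> (forall i, J 'X_i) -> forall p, p.@[fun=> 0] = 0 -> J p.
Proof.
move=> Jid JX p p0; have [J0 JD JM] := Jid.
rewrite -[p]subr0 -(mpolyC0 n k) -p0.
apply: (@generated_mpoly k n (fun p => J (p - p.@[fun=> 0]%:MP))).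
- by move=> c; rewrite mevalC subrr.
- by move=> _ /mapP[i _ ->]; rewrite mevalXU mpolyC0 subr0.
- move=> x y hx hy; rewrite mevalD mpolyCD opprD addrACA; exact: JD.
- move=> x y hx hy; rewrite mevalM mpolyCM.
  set a := _%:MP in hx *; set b := _%:MP in hy *.
  have -> : x * y - a * b = y * (x - a) + a * (y - b) by ring.
  by apply: JD; apply: (JM).
Qed.

(** * Stanley-Reisner rings of whiskered graphs *)

Section StanleyReisnerRing.
Variables (k : fieldType) (n : nat) (D : scomplex n).
Local Notation pi := (@sr_pi k n D).

Lemma sr_pi_zmod_morphism : zmod_morphism pi.
Proof. by move=> x y; rewrite /sr_pi rmorphB. Qed.

Lemma sr_pi_monoid_morphism : monoid_morphism pi.
Proof. by split=> [|x y]; rewrite /sr_pi ?rmorph1 ?rmorphM. Qed.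

HB.instance Definition _ := GRing.isZmodMorphism.Build _ _ (@sr_pi k n D)
  sr_pi_zmod_morphism.
HB.instance Definition _ := GRing.isMonoidMorphism.Build _ _ (@sr_pi k n D)
  sr_pi_monoid_morphism.

Lemma sr_pi_surj (r : sr_ring k D) : exists p, pi p = r.
Proof. by exists (repr r); apply: reprK. Qed.

Lemma sr_pi_eq0 p : pi p = 0 <-> p \in @sr_ideal k n D.
Proof.
rewrite -[p in p \in _]subr0 Quotient.idealrBE; split=> [pE|/eqP pE].
  by apply/eqP; rewrite [LHS]pE [RHS]rmorph0.
by rewrite /sr_pi pE [LHS]rmorph0.
Qed.

Lemma generated_sr_ring :
  generated (pi \o @mpolyC n k) (map pi [seq 'X_i | i <- enum 'I_n]).
Proof. exact: generated_image sr_pi_surj (@generated_mpoly k n). Qed.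

Lemma noetherian_sr_ring : noetherian (sr_ring k D).
Proof. exact: noetherian_generated (@noetherian_field k) generated_sr_ring. Qed.

End StanleyReisnerRing.

Section EdgeIdeal.
Variables (k : fieldType) (n : nat) (G : sgraph n).
Local Notation D := (independent_complex G).

Lemma sr_pi_edge u v : G u v -> sr_pi D ('X_u : {mpoly k[n]}) * sr_pi D 'X_v = 0.
Proof.
move=> uv; rewrite -rmorphM; apply/sr_pi_eq0/asboolP; apply: mem_ideal_gen.
have nuv : u != v by apply: contraTneq uv => ->; rewrite edge_irrefl.
exists [set u; v]; last by rewrite big_setU1 ?inE // big_set1.
rewrite inE; apply/negP => /forall_inP /(_ u); rewrite !inE eqxx => /(_ isT).
by move/forall_inP/(_ v); rewrite !inE eqxx orbT uv => /(_ isT).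
Qed.

(** A set that is not independent contains an edge, so its monomial is a multiple of an edge
    monomial. *)
Lemma sr_ideal_edges (J : {mpoly k[n]} -> Prop) : is_ideal J ->
  (forall u v, G u v -> J ('X_u * 'X_v)) ->
  forall p, p \in @sr_ideal k n D -> J p.
Proof.
move=> Jid Je p /asboolP; apply=> // _ [F FD ->]; have [_ _ JM] := Jid.
move: FD; rewrite inE negb_forall_in => /exists_inP[u uF].
rewrite negb_forall_in => /exists_inP[v vF]; rewrite negbK => uv.
have nuv : v != u by apply: contraTneq uv => ->; rewrite edge_irrefl.
rewrite (bigD1 u) //= (bigD1 v) ?vF //= mulrA mulrC; exact/JM/Je.
Qed.

Lemma sr_ideal_ker (Q : comNzRingType) (phi : {rmorphism {mpoly k[n]} -> Q}) :
  (forall u v, G u v -> phi 'X_u * phi 'X_v = 0) ->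
  forall p, p \in @sr_ideal k n D -> phi p = 0.
Proof.
move=> phie; apply: (@sr_ideal_edges (fun p => phi p = 0)) => [|u v uv].
  split=> [|x y px py|a x px]; first exact: rmorph0.
    by rewrite rmorphD px py addr0.
  by rewrite rmorphM px mulr0.
by rewrite rmorphM phie.
Qed.

Definition sr_lift (Q : comNzRingType) (phi : {rmorphism {mpoly k[n]} -> Q})
    (phie : forall u v, G u v -> phi 'X_u * phi 'X_v = 0) :
    {rmorphism sr_ring k D -> Q} :=
  quot_lift (sr_ideal_ker phie).

Lemma sr_liftE Q phi phie p : @sr_lift Q phi phie (sr_pi D p) = phi p.
Proof. exact: quot_liftE. Qed.

End EdgeIdeal.

Section Whisker.
Variables (k : fieldType) (N d : nat) (h : rel 'I_N) (col : 'I_N -> 'I_d).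
Hypotheses (h_sym : ssrbool.symmetric h) (h_irr : irreflexive h).
Hypothesis h_col : forall a b, a != b -> col a = col b -> h a b.

(* Clique whiskering: the cliques are the fibres of col, and lshift N c is    *)
(* the whisker of the fibre of c.                                             *)
Definition whisker_edge : rel 'I_(d + N) := fun u v =>
  match split u, split v with
  | inl _, inl _ => false
  | inl c, inr a | inr a, inl c => col a == c
  | inr a, inr b => h a b
  end.

Lemma whisker_sym : ssrbool.symmetric whisker_edge.
Proof.
by move=> u v; rewrite /whisker_edge; case: (split u) (split v) => [?|?] [?|?].
Qed.

Lemma whisker_irrefl : irreflexive whisker_edge.
Proof. by move=> u; rewrite /whisker_edge; case: (split u). Qed.

Definition whisker : sgraph (d + N) := SGraph whisker_sym whisker_irrefl.

Local Notation S := {mpoly k[d + N]}.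
Local Notation B := {mpoly k[d]}.
Local Notation D := (independent_complex whisker).
Local Notation R := (sr_ring k D).
Local Notation pi := (@sr_pi k _ D).

Definition wvar c : S := 'X_(lshift N c).
Definition xvar a : S := 'X_(rshift d a).
Definition theta c : S := wvar c + \sum_(a | col a == c) xvar a.

Lemma split_lshift c : split (lshift N c) = inl c :> 'I_d + 'I_N.
Proof. exact: (unsplitK (inl c)). Qed.
Lemma split_rshift a : split (rshift d a) = inr a :> 'I_d + 'I_N.
Proof. exact: (unsplitK (inr a)). Qed.

Lemma whisker_varP (Q : 'I_(d + N) -> Prop) :
  (forall c, Q (lshift N c)) -> (forall a, Q (rshift d a)) -> forall v, Q v.
Proof. by move=> Ql Qr v; rewrite -(splitK v); case: split. Qed.

Implicit Types F : {set 'I_N}.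

(** The independent sets of the graph before whiskering. *)
Definition clear_set (F : {set 'I_N}) :=
  [forall a in F, forall b in F, ~~ h a b].

Lemma clear_sub (F F' : {set 'I_N}) : F' \subset F -> clear_set F -> clear_set F'.
Proof.
move=> /subsetP sub /forall_inP hF; apply/forall_inP => a /sub /hF /forall_inP hFa.
by apply/forall_inP => b /sub /hFa.
Qed.

Lemma clear_setP (F : {set 'I_N}) a b : clear_set F -> a \in F -> b \in F -> ~~ h a b.
Proof. by move=> /forall_inP hF /hF /forall_inP; apply. Qed.

Lemma clear_col (F : {set 'I_N}) a b : clear_set F -> a \in F -> b \in F -> col a = col b -> a = b.
Proof.
move=> hF aF bF cab; apply/eqP/negP => /negP nab.
by have := clear_setP hF aF bF; rewrite h_col.
Qed.

Lemma clear0 : clear_set set0.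
Proof. by apply/forall_inP => a; rewrite inE. Qed.

Lemma whisker_edge_ind (Q : 'I_(d + N) -> 'I_(d + N) -> Prop) :
  (forall u v, Q u v -> Q v u) ->
  (forall a, Q (lshift N (col a)) (rshift d a)) ->
  (forall a b, h a b -> Q (rshift d a) (rshift d b)) ->
  forall u v, whisker u v -> Q u v.
Proof.
move=> Qsym Qwx Qxx.
elim/whisker_varP => [c|a]; elim/whisker_varP => [c'|b] /=;
  rewrite /whisker_edge ?split_lshift ?split_rshift //.
- by move=> /eqP<-; apply: Qwx.
- by move=> /eqP<-; apply/Qsym/Qwx.
- exact: Qxx.
Qed.

Let W c : R := pi (wvar c).
Let X a : R := pi (xvar a).
Let th c : R := pi (theta c).
Let e (F : {set 'I_N}) : R := pi (\prod_(a in F) xvar a).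

Lemma pi_xx a b : h a b -> X a * X b = 0.
Proof.
move=> hab; apply: sr_pi_edge.
by rewrite /= /whisker_edge !split_rshift.
Qed.

Lemma pi_wx a : W (col a) * X a = 0.
Proof.
by apply: sr_pi_edge; rewrite /= /whisker_edge split_lshift split_rshift.
Qed.

Lemma pi_thetaE c : th c = W c + \sum_(a | col a == c) X a.
Proof. by rewrite /th rmorphD rmorph_sum. Qed.

(** The whisker and the other vertices of the clique of [a] are all adjacent to [a], so only x_a
    itself survives in theta. *)
Lemma pi_theta_x a : th (col a) * X a = X a * X a.
Proof.
rewrite pi_thetaE mulrDl pi_wx add0r mulr_suml (bigD1 a) //= big1 ?addr0 //.
by move=> b /andP[/eqP cb ab]; rewrite pi_xx // h_col.
Qed.

Lemma pi_prodE F : e F = \prod_(a in F) X a.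
Proof. exact: rmorph_prod. Qed.

Lemma pi_x_mem a F : a \in F -> X a * e F = th (col a) * e F.
Proof.
move=> aF; rewrite pi_prodE (big_setD1 a) //= mulrA -pi_theta_x.
by rewrite mulrA.
Qed.

Lemma pi_x_notin a F : a \notin F -> X a * e F = e (a |: F).
Proof. by move=> aF; rewrite !pi_prodE big_setU1. Qed.

Lemma pi_prod_dep F : ~~ clear_set F -> e F = 0.
Proof.
rewrite negb_forall_in => /exists_inP[a aF].
rewrite negb_forall_in => /exists_inP[b bF]; rewrite negbK => hab.
have nab : b != a by apply: contraTneq hab => ->; rewrite h_irr.
by rewrite pi_prodE (bigD1 a) //= (bigD1 b) ?bF //= mulrA pi_xx // mul0r.
Qed.

Definition param : {rmorphism B -> S} := mmap (@mpolyC (d + N) k) theta.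

Lemma paramC c : param c%:MP = c%:MP.
Proof. exact: mmapC. Qed.
Lemma paramX c : param 'X_c = theta c.
Proof. by rewrite /param /= mmapX mmap1U. Qed.

Let io (b : B) : R := pi (param b).

Lemma param_piM b b' : io (b * b') = io b * io b'.
Proof. by rewrite /io !rmorphM. Qed.
Lemma param_piC c : pi c%:MP = io c%:MP.
Proof. by rewrite /io paramC. Qed.
Lemma param_piX c : th c = io 'X_c.
Proof. by rewrite /io paramX. Qed.

Lemma whisker_ring_ind (Q : R -> Prop) :
  (forall c, Q (pi c%:MP)) -> (forall c, Q (th c)) -> (forall a, Q (X a)) ->
  (forall x y, Q x -> Q y -> Q (x + y)) ->
  (forall x y, Q x -> Q y -> Q (x * y)) -> forall r, Q r.
Proof.
move=> QC Qt Qx QD QM.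
have Q0 : Q 0 by have := QC 0; rewrite !rmorph0.
apply: (@generated_sr_ring k _ D _ QC _ QD QM).
move=> _ /mapP[_ /mapP[v _ ->] ->]; elim/whisker_varP: v => [c|]; last exact: Qx.
have -> : pi 'X_(lshift N c) = th c + pi (- 1)%:MP * \sum_(a | col a == c) X a.
  by rewrite !rmorphN !rmorph1 mulN1r pi_thetaE addrK.
by apply: (QD) => //; apply: QM => //; apply: (big_ind Q Q0 QD).
Qed.

(** The extension of [J] to [R], described by coefficients. Taking [J] to be all of [B] gives
    spanning; an ideal generated by a list gives coefficientwise membership ([span_ideal_coef]). *)
Definition span_ideal (J : B -> Prop) (r : R) : Prop :=
  exists2 b : {set 'I_N} -> B, (forall F, J (b F)) &
    r = \sum_(F | clear_set F) io (b F) * e F.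

(** Stability under multiplication is checked on ring generators: constants and thetas scale the
    coefficients, while x_a either acts as its theta on [e F] or sends it to [e (a |: F)], which is
    zero unless that set is independent. *)
Lemma span_ideal_ideal J : is_ideal J -> is_ideal (span_ideal J).
Proof.
move=> Jid; have [J0 JD JM] := Jid.
have sp0 : span_ideal J 0.
  exists (fun=> 0) => //; rewrite big1 // => F _.
  by rewrite /io !rmorph0 mul0r.
have spD x y : span_ideal J x -> span_ideal J y -> span_ideal J (x + y).
  move=> [b Jb ->] [c Jc ->]; exists (fun F => b F + c F) => [F|]; first exact: JD.
  by rewrite -big_split; apply: eq_bigr => F _; rewrite /io !rmorphD mulrDl.
have sp1 b F : J b -> span_ideal J (io b * e F).
  move=> Jb; have [hF|hF] := boolP (clear_set F); last first.
    by rewrite pi_prod_dep // mulr0.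
  exists (fun G => if G == F then b else 0) => [G|]; first by case: eqP.
  rewrite (bigD1 F) //= eqxx big1 ?addr0 // => G /andP[_ /negPf ->].
  by rewrite /io !rmorph0 mul0r.
split=> //.
suff spM a : forall r, span_ideal J r -> span_ideal J (a * r) by [].
have spM1 p : (forall b F, J b -> span_ideal J (p * (io b * e F))) ->
    forall r, span_ideal J r -> span_ideal J (p * r).
  move=> hp r [b Jb ->]; rewrite mulr_sumr.
  by elim/big_ind: _ => // F _; apply: hp.
elim/whisker_ring_ind: a => [c|c|a|x y hx hy r hr|x y hx hy r hr].
- apply: (spM1) => b F Jb.
  by rewrite mulrA param_piC -param_piM; apply: (sp1); apply: (JM).
- apply: (spM1) => b F Jb.
  by rewrite mulrA param_piX -param_piM; apply: (sp1); apply: (JM).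
- apply: (spM1) => b F Jb; rewrite mulrCA.
  have [aF|aF] := boolP (a \in F); last by rewrite pi_x_notin //; apply: (sp1).
  by rewrite pi_x_mem // mulrA param_piX -param_piM [b * _]mulrC; apply: (sp1); apply: (JM).
- by rewrite mulrDl; apply: spD; [apply: hx | apply: hy].
- by rewrite -mulrA; apply/hx/hy.
Qed.

Lemma span_ideal_io J b : is_ideal J -> J b -> span_ideal J (io b).
Proof.
move=> Jid Jb; have [J0 _ _] := Jid.
exists (fun F => if F == set0 then b else 0) => [F|]; first by case: eqP.
rewrite (bigD1 set0) ?clear0 //= eqxx /e big_set0 rmorph1 mulr1 big1 ?addr0 //.
by move=> F /andP[_ /negPf ->]; rewrite /io !rmorph0 mul0r.
Qed.

Lemma spanP r : exists b : {set 'I_N} -> B,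
  r = \sum_(F | clear_set F) io (b F) * e F.
Proof.
have Tid : is_ideal (fun _ : B => True) by [].
have [_ _ TM] := span_ideal_ideal Tid.
have := TM r _ (@span_ideal_io _ 1 Tid I); rewrite /io !rmorph1 mulr1.
by case=> b _ ->; exists b.
Qed.

(** Restriction to the facet formed by [F] and the whiskers of the cliques that miss [F]: each of
    its vertices becomes the variable of its clique, all others become zero. For independent [F] it
    is a retraction of [param] ([facet_map_param]). *)
Definition facet_map (F : {set 'I_N}) : {rmorphism S -> B} :=
  mmap (@mpolyC d k) (fun v => match split v with
    | inl c => if c \in col @: F then 0 else 'X_c
    | inr a => if a \in F then 'X_(col a) else 0 end).

Lemma facet_mapC F c : facet_map F c%:MP = c%:MP.
Proof. exact: mmapC. Qed.
Lemma facet_mapW F c : facet_map F (wvar c) = if c \in col @: F then 0 else 'X_c.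
Proof. by rewrite /facet_map /= mmapX mmap1U split_lshift. Qed.
Lemma facet_mapX F a : facet_map F (xvar a) = if a \in F then 'X_(col a) else 0.
Proof. by rewrite /facet_map /= mmapX mmap1U split_rshift. Qed.

Lemma facet_map_edge (F : {x | clear_set x}) u v :
  whisker u v -> facet_map (val F) 'X_u * facet_map (val F) 'X_v = 0.
Proof.
move: u v; apply: whisker_edge_ind => [u v|a|a b hab].
- by rewrite mulrC.
- rewrite [facet_map _ 'X_(lshift _ _)]facet_mapW [facet_map _ _]facet_mapX.
  have [aF|] := boolP (a \in val F); last by rewrite mulr0.
  by rewrite imset_f // mul0r.
- rewrite [facet_map _ 'X_(rshift _ a)]facet_mapX [facet_map _ _]facet_mapX.
  have [aF|] := boolP (a \in val F); last by rewrite mul0r.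
  have [bF|] := boolP (b \in val F); last by rewrite mulr0.
  by have := clear_setP (valP F) aF bF; rewrite hab.
Qed.

Definition facet_proj (F : {x | clear_set x}) : {rmorphism R -> B} :=
  sr_lift (@facet_map_edge F).

Lemma facet_projE (F : {x | clear_set x}) p : facet_proj F (pi p) = facet_map (val F) p.
Proof. exact: sr_liftE. Qed.

Lemma facet_map_param F b : clear_set F -> facet_map F (param b) = b.
Proof.
move=> hF; rewrite -[LHS]/((facet_map F \o param) b) -[RHS]/(idfun b).
apply: mpoly_rmorph_eq => [c|c] /=; first by rewrite paramC facet_mapC.
rewrite paramX rmorphD rmorph_sum /= facet_mapW.
under eq_bigr => a _ do rewrite facet_mapX.
have [/imsetP[a aF cE]|cF] := boolP (c \in col @: F).
  rewrite add0r (bigD1 a) ?cE //= aF big1 ?addr0 // => b' /andP[/eqP cb ba].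
  by case: ifP => // bF; case/eqP: ba; apply: clear_col hF _ _ cb.
rewrite big1 ?addr0 // => a /eqP ca; case: ifP => // aF.
by rewrite -ca imset_f in cF.
Qed.

Lemma facet_map_prod F F' : facet_map F (\prod_(a in F') xvar a) =
  if F' \subset F then \prod_(a in F') 'X_(col a) else 0.
Proof.
rewrite rmorph_prod; case: ifP => [/subsetP sub|/negbT /subsetPn[a aF' aF]].
  by apply: eq_bigr => a /sub aF; rewrite facet_mapX aF.
by rewrite (bigD1 a) //= facet_mapX (negPf aF) mul0r.
Qed.

(* The facet projections are triangular in the coefficients, for inclusion of *)
(* the faces.                                                                 *)
Lemma span_unique (b : {set 'I_N} -> B) :
  (forall F : {x | clear_set x},
     facet_proj F (\sum_(F' | clear_set F') io (b F') * e F') = 0) ->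
  forall F, clear_set F -> b F = 0.
Proof.
move=> b0 F; have [m] := ubnP #|F|; elim: m F => // m IH F; rewrite ltnS => szF hF.
have := b0 (exist _ F hF).
have: forall p, facet_proj (exist _ F hF) (pi p) = facet_map F p.
  exact: facet_projE.
move: (facet_proj _) => psi psiE; rewrite rmorph_sum (bigD1 F) //= big1 => [|F'].
  rewrite addr0 rmorphM !psiE facet_map_param // facet_map_prod subxx.
  move/eqP; rewrite mulf_eq0 => /orP[/eqP //|/prodf_eq0[a _]].
  by rewrite -msize_poly_eq0 msizeX.
move=> /andP[hF' FF']; rewrite rmorphM !psiE.
rewrite facet_map_prod; case: ifP => [sub|_]; last by rewrite mulr0.
rewrite IH ?rmorph0 ?mul0r //; apply: leq_trans szF.
by rewrite proper_card // properEneq FF'.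
Qed.

(** So [R] embeds in a finite product of polynomial rings in [d] variables, the setting of
    [regular_chain_bound]. *)
Lemma facet_proj_inj r : (forall F : {x | clear_set x}, facet_proj F r = 0) -> r = 0.
Proof.
have [b ->] := spanP r => /span_unique b0.
by apply: big1 => F /b0 ->; rewrite /io !rmorph0 mul0r.
Qed.

Lemma span_coef_eq (b b' : {set 'I_N} -> B) :
  \sum_(F | clear_set F) io (b F) * e F =
    \sum_(F | clear_set F) io (b' F) * e F ->
  forall F, clear_set F -> b F = b' F.
Proof.
move=> bb' F hF; apply/eqP; rewrite -subr_eq0; apply/eqP.
apply: (span_unique (b := fun F => b F - b' F)) => // F'.
rewrite (_ : \sum_(F | _) _ = 0) ?rmorph0 //.
transitivity (\sum_(F | clear_set F) (io (b F) * e F - io (b' F) * e F)).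
  by apply: eq_bigr => G _; rewrite /io !rmorphB mulrBl.
by rewrite sumrB bb' subrr.
Qed.

Let zero_ideal_B := @zero_ideal_ideal B.
Let zero_ideal_R := @zero_ideal_ideal R.

Lemma param_ideal (gs : seq B) b :
  ideal_adds (@zero_ideal B) gs b -> ideal_adds (@zero_ideal R) (map io gs) (io b).
Proof.
have Jid := ideal_adds_ideal (map io gs) zero_ideal_R.
apply: (@ideal_adds_min _ _ (fun b => ideal_adds _ (map io gs) (io b))).
- have [J0 JD JM] := Jid; split=> [|x y hx hy|x y hy].
  + by rewrite /io !rmorph0.
  + by rewrite /io !rmorphD; apply: (JD).
  + by rewrite param_piM; apply: (JM).
- by move=> _ ->; rewrite /io !rmorph0; have [] := Jid.
- by move=> a ags; apply: mem_ideal_adds => //; apply: map_f.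
Qed.

Lemma span_ideal_coef (gs : seq B) (b : {set 'I_N} -> B) :
  ideal_adds (@zero_ideal R) (map io gs) (\sum_(F | clear_set F) io (b F) * e F) ->
  forall F, clear_set F -> ideal_adds (@zero_ideal B) gs (b F).
Proof.
move=> hb F hF; have Jid := ideal_adds_ideal gs zero_ideal_B.
have : span_ideal (ideal_adds (@zero_ideal B) gs)
    (\sum_(F | clear_set F) io (b F) * e F).
  apply: ideal_adds_min hb; first exact: span_ideal_ideal.
    by move=> _ ->; have [] := span_ideal_ideal Jid.
  move=> _ /mapP[g ggs ->]; apply: span_ideal_io => //.
  exact: mem_ideal_adds.
by case=> b' Jb' /span_coef_eq ->.
Qed.

(** By freeness, multiplication by an element of [B] and membership in an ideal extended from [B]
    are both read coefficient by coefficient. *)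
Lemma regular_param (gs : seq B) :
  regular_mod (@zero_ideal B) gs -> regular_mod (@zero_ideal R) (map io gs).
Proof.
move=> reg i; rewrite size_map => lti y; rewrite -map_take (nth_map 0) //.
have [b ->] := spanP y; rewrite mulr_sumr.
under eq_bigr => F _ do rewrite mulrA -param_piM.
move=> hb; have [_ _ JM] := ideal_adds_ideal (map io (take i gs)) zero_ideal_R.
apply: ideal_sum => [|F hF]; first exact: ideal_adds_ideal.
rewrite mulrC; apply: (JM); apply: param_ideal; apply: reg => //.
exact: (span_ideal_coef hb).
Qed.

Definition eval_at (f : {poly k}) (c : 'I_d) : B := (map_poly (@mpolyC d k) f).['X_c].

Definition poly_var (i : 'I_d) : {rmorphism B -> {poly B}} :=
  mmap (polyC \o @mpolyC d k) (fun j => if j == i then 'X else ('X_j)%:P).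

Lemma poly_varC i c : poly_var i c%:MP = c%:MP%:P.
Proof. exact: mmapC. Qed.

Lemma poly_varX i j : poly_var i 'X_j = if j == i then 'X else ('X_j)%:P.
Proof. by rewrite /poly_var /= mmapX mmap1U. Qed.

Lemma poly_var_eval i f c : poly_var i (eval_at f c) =
  if c == i then map_poly (@mpolyC d k) f else (eval_at f c)%:P.
Proof.
rewrite /eval_at -horner_map -map_poly_comp.
have -> : map_poly (poly_var i \o @mpolyC d k) f =
    map_poly polyC (map_poly (@mpolyC d k) f).
  by rewrite -map_poly_comp; apply: eq_map_poly => a; apply: poly_varC.
rewrite [poly_var i 'X_c]poly_varX; case: eqP => _; first exact: comp_polyXr.
by rewrite horner_map.
Qed.

(** Each element is monic in its own variable and free of the others, so [regular_by_subst] applies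
    with that variable as the new one. *)
Lemma regular_eval (f : 'I_d -> {poly k}) : (forall c, f c \is monic) ->
  regular_mod (@zero_ideal B) [seq eval_at (f c) c | c <- enum 'I_d].
Proof.
move=> fm; apply: regular_by_subst => i; rewrite size_map size_enum_ord => lti.
pose c := Ordinal lti; exists (poly_var c), 'X_c.
have nthE j (ltj : (j < d)%N) : nth 0 [seq eval_at (f c) c | c <- enum 'I_d] j =
    eval_at (f (Ordinal ltj)) (Ordinal ltj).
  rewrite (nth_map c) ?size_enum_ord //; congr (eval_at (f _) _);
    by apply/val_inj; rewrite /= nth_enum_ord.
split=> [x|j ltj|].
- rewrite -[LHS]/((horner_eval 'X_c \o poly_var c) x) -[RHS]/(idfun x).
  apply: mpoly_rmorph_eq => [a|j] /=.
    by rewrite [poly_var _ _]poly_varC /horner_eval hornerC.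
  rewrite [poly_var _ _]poly_varX /horner_eval.
  by case: eqP => [->|_]; rewrite ?hornerX ?hornerC.
- rewrite (nthE _ (ltn_trans ltj lti)) poly_var_eval ifN //.
  by rewrite -val_eqE /= ltn_eqF.
- by rewrite (nthE _ lti) poly_var_eval eqxx map_monic.
Qed.

Definition thetas : seq R := [seq th c | c <- enum 'I_d].

Lemma regular_thetas : regular_mod (@zero_ideal R) thetas.
Proof.
have -> : thetas = map io [seq eval_at 'X c | c <- enum 'I_d].
  rewrite -map_comp; apply: eq_map => c.
  by rewrite /= /eval_at map_polyX hornerX param_piX.
by apply/regular_param/regular_eval => c; apply: monicX.
Qed.

(* Substituting w_c := - sum of the x_a in the fibre of c divides out the     *)
(* thetas; the clear squarefree monomials remain a basis, and kap F is the    *)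
(* coordinate on that of F.                                                   *)
Definition sigma : {rmorphism S -> {mpoly k[N]}} :=
  mmap (@mpolyC N k) (fun v => match split v with
    | inl c => - \sum_(a | col a == c) 'X_a
    | inr a => 'X_a end).

Lemma sigmaC c : sigma c%:MP = c%:MP.
Proof. exact: mmapC. Qed.
Lemma sigmaW c : sigma (wvar c) = - \sum_(a | col a == c) 'X_a.
Proof. by rewrite /sigma /= mmapX mmap1U split_lshift. Qed.
Lemma sigmaX a : sigma (xvar a) = 'X_a.
Proof. by rewrite /sigma /= mmapX mmap1U split_rshift. Qed.

Definition kap F (p : S) : k := (sigma p)@_(mesym1 F).

Lemma kapD F p q : kap F (p + q) = kap F p + kap F q.
Proof. by rewrite /kap rmorphD mcoeffD. Qed.
Lemma kapN F p : kap F (- p) = - kap F p.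
Proof. by rewrite /kap rmorphN mcoeffN. Qed.
Lemma kap0 F : kap F 0 = 0.
Proof. by rewrite /kap rmorph0 mcoeff0. Qed.
Lemma kap_sum F (T : Type) (r : seq T) P (f : T -> S) :
  kap F (\sum_(i <- r | P i) f i) = \sum_(i <- r | P i) kap F (f i).
Proof. exact: (big_morph (kap F) (kapD F) (kap0 F)). Qed.
Lemma kapC F c p : kap F (c%:MP * p) = c * kap F p.
Proof. by rewrite /kap rmorphM sigmaC mcoeffCM. Qed.

Lemma kap_x F a p : kap F (xvar a * p) = if a \in F then kap (F :\ a) p else 0.
Proof.
rewrite /kap rmorphM sigmaX mulrC; case: ifP => aF.
  have -> : mesym1 F = (U_(a) + mesym1 (F :\ a))%MM.
    apply/mnmP => i; rewrite mnmDE mnm1E !mnmE in_setD1 eq_sym.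
    by case: eqP => [->|]; rewrite ?aF.
  exact: mcoeffMX.
apply: memN_msupp_eq0; rewrite (perm_mem (msuppMX _ _)).
apply/mapP => -[m _ /mnmP /(_ a)]; rewrite mnmE aF mnmDE mnm1E eqxx.
by [].
Qed.

Lemma kap_w F c p :
  kap F (wvar c * p) = - \sum_(a | col a == c) kap F (xvar a * p).
Proof.
rewrite -kap_sum -kapN -mulr_suml -mulNr /kap !rmorphM rmorphN rmorph_sum sigmaW.
by congr ((- _ * _)@_ _); apply: eq_bigr => a _; rewrite sigmaX.
Qed.

Lemma kap_prod G F : kap G (\prod_(a in F) xvar a) = (F == G)%:R.
Proof.
rewrite /kap rmorph_prod.
have -> : \prod_(a in F) sigma (xvar a) = 'X_[mesym1 F].
  rewrite mpolyXE_id big_mkcond; apply: eq_bigr => a _.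
  by rewrite sigmaX mnmE; case: (a \in F).
by rewrite mcoeffX (inj_eq (@inj_mesym1 N)).
Qed.

Lemma kap_homog e' F p : p \is e'.-homog -> #|F| <> e' -> kap F p = 0.
Proof.
move=> /dhomogP hp neF; rewrite /kap.
have hv v : sigma 'X_v \is 1.-homog.
  elim/whisker_varP: v => [c|a]; rewrite [sigma _](sigmaW, sigmaX).
    by rewrite rpredN rpred_sum // => a _; rewrite dhomogX /= mdeg1.
  by rewrite dhomogX /= mdeg1.
have hm m : sigma 'X_[m] \is (mdeg m).-homog.
  rewrite mpolyXE_id rmorph_prod mdegE.
  elim/big_rec2: _ => [|v y q _ hq]; first exact: dhomog1.
  apply: dhomogM => //; rewrite rmorphXn.
  by have := dhomogMn (m v) (hv v); rewrite mul1n.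
suff hs : sigma p \is e'.-homog.
  by apply: dhomog_nemf_coeff hs _; rewrite /= mdeg_mesym1; apply/eqP.
rewrite [p]mpolyE rmorph_sum big_seq rpred_sum // => m /hp <-.
by rewrite -mul_mpolyC rmorphM sigmaC mul_mpolyC dhomogZ.
Qed.

(** This is the preimage in [S] of the ideal of the thetas of [R] ([thetas_killed]), presented by
    finitely many linear conditions. *)
Definition killed (p : S) : Prop := forall F, clear_set F -> kap F p = 0.

(** Multiplication by x_a shifts the coordinate at [F] to the one at [F] without [a], and subsets of
    independent sets are independent. *)
Lemma killed_ideal : is_ideal killed.
Proof.
split=> [F _|p q hp hq F hF|p]; first exact: kap0.
  by rewrite kapD hp // hq // addr0.
have kx a q : killed q -> killed (xvar a * q).
  move=> hq F hF; rewrite kap_x; case: ifP => // _; apply: hq.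
  by apply: clear_sub hF; apply: subsetDl.
apply: (@generated_mpoly k _ (fun p => forall q, killed q -> killed (p * q))).
- by move=> c q hq F hF; rewrite kapC hq // mulr0.
- move=> _ /mapP[v _ ->]; elim/whisker_varP: v => [c|a] q hq; last exact: kx.
  by move=> F hF; rewrite [kap _ _]kap_w big1 ?oppr0 // => a _; apply: kx.
- by move=> x y hx hy q hq F hF; rewrite mulrDl kapD hx // hy // addr0.
- by move=> x y hx hy q hq; rewrite -mulrA; apply/hx/hy.
Qed.

Lemma kap_xx F a b : clear_set F -> a = b \/ h a b -> kap F (xvar a * xvar b) = 0.
Proof.
move=> hF ab; rewrite kap_x; case: ifP => // aF.
rewrite -[xvar b]mulr1 kap_x in_setD1; case: ifP => // /andP[ba bF].
case: ab => [ab|hab]; first by rewrite ab eqxx in ba.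
by have := clear_setP hF aF bF; rewrite hab.
Qed.

Lemma killed_sr_ideal p : p \in @sr_ideal k _ D -> killed p.
Proof.
apply: sr_ideal_edges; first exact: killed_ideal.
apply: whisker_edge_ind => [u v|a|a b hab F hF].
- by rewrite mulrC.
- move=> F hF; rewrite [kap _ _]kap_w big1 ?oppr0 // => b /eqP cb.
  apply: kap_xx => //; have [->|nba] := eqVneq b a; first by left.
  by right; apply: h_col.
- by apply: kap_xx => //; right.
Qed.

Lemma kap_theta F c : kap F (theta c) = 0.
Proof.
rewrite /kap rmorphD rmorph_sum sigmaW.
by under [X in _ + X]eq_bigr => a _ do rewrite sigmaX; rewrite addNr mcoeff0.
Qed.

Lemma thetas_killed p : ideal_adds (@zero_ideal R) thetas (pi p) <-> killed p.
Proof.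
have [K0 KD KM] := killed_ideal.
have ideal_killed q : ideal_adds (@zero_ideal R) thetas (pi q) -> killed q.
  move=> hq; suff [p' pE hp'] : exists2 p', pi p' = pi q & killed p'.
    rewrite -(subrK p' q); apply: (KD) => //; apply: killed_sr_ideal.
    by apply/sr_pi_eq0; rewrite rmorphB /= pE subrr.
  move: hq; apply: (@ideal_adds_min _ _
    (fun r => exists2 p', pi p' = r & killed p')).
  - split=> [|_ _ [x <- hx] [y <- hy]|a _ [x <- hx]].
    + by exists 0; rewrite ?rmorph0.
    + by exists (x + y); rewrite ?rmorphD //; apply: KD.
    + have [b <-] := sr_pi_surj a.
      by exists (b * x); rewrite ?rmorphM //; apply: KM.
  - by move=> _ ->; exists 0; rewrite ?rmorph0.
  - move=> _ /mapP[c _ ->]; exists (theta c) => // F _; exact: kap_theta.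
split; first exact: ideal_killed.
have Jid := ideal_adds_ideal thetas zero_ideal_R; have [J0 JD JM] := Jid.
have [b pE] := spanP (pi p).
(* [q] keeps the constant terms of the coefficients of [p]. The rest lies in the ideal of the
   thetas, and [kap] reads these constants off [q]. *)
pose q := \sum_(F | clear_set F) (b F).@[fun=> 0]%:MP * \prod_(a in F) xvar a.
have pq : ideal_adds (@zero_ideal R) thetas (pi (p - q)).
  rewrite rmorphB /= pE rmorph_sum -sumrB; apply: ideal_sum => // F _.
  rewrite [X in _ - X]rmorphM /= -mulrBl mulrC; apply: (JM).
  rewrite param_piC /io -!rmorphB -/(io _).
  apply: (@mpoly_aug_ideal _ _ (fun x => ideal_adds _ thetas (io x))).
  - split=> [|x y hx hy|x y hy]; first by rewrite /io !rmorph0.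
      by rewrite /io !rmorphD; apply: (JD).
    by rewrite param_piM; apply: (JM).
  - move=> c; rewrite -param_piX; apply: mem_ideal_adds => //.
    by apply: map_f; rewrite mem_enum.
  - by rewrite mevalB mevalC subrr.
move=> kp; rewrite -(subrK q p) rmorphD /=; apply: (JD) => //.
suff -> : pi q = 0 by [].
rewrite rmorph_sum big1 // => F hF.
have kq : killed q.
  have -> : q = p - (p - q) by rewrite opprB addrC subrK.
  by apply: idealB killed_ideal kp _; apply: ideal_killed.
have := kq F hF; rewrite kap_sum (bigD1 F) //=.
rewrite [X in _ + X]big1; last first.
  by move=> G /andP[_ GF]; rewrite kapC kap_prod (negPf GF) mulr0.
by rewrite kapC kap_prod eqxx mulr1 addr0 => ->; rewrite !rmorph0 mul0r rmorph0.
Qed.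

(** When [a |: F] is independent and [xvar a * p] is killed, this forces the coordinate of [p] at
    [F] to vanish: socle elements live on maximal independent sets. *)
Lemma kap_nonmax F a p : a \notin F -> kap (a |: F) (xvar a * p) = kap F p.
Proof. by move=> aF; rewrite kap_x setU11 setU1K. Qed.

End Whisker.

(** * Tor of a whiskered graph *)

Section WhiskerTor.
Variables (k : fieldType) (N d : nat) (h : rel 'I_N) (col : 'I_N -> 'I_d).
Hypotheses (h_sym : ssrbool.symmetric h) (h_irr : irreflexive h).
Hypothesis h_col : forall a b, a != b -> col a = col b -> h a b.

Local Notation S := {mpoly k[d + N]}.
Local Notation B := {mpoly k[d]}.
Local Notation D := (independent_complex (whisker col h_sym h_irr)).
Local Notation R := (sr_ring k D).
Local Notation pi := (@sr_pi k _ D).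
Local Notation wvar := (@wvar k N d).
Local Notation xvar := (@xvar k N d).
Local Notation theta := (theta k col).
Local Notation thetas := (@thetas k N d h col h_sym h_irr).
Implicit Types F : {set 'I_N}.

Let X a : R := pi (xvar a).
Let th c : R := pi (theta c).
Let e (F : {set 'I_N}) : R := pi (\prod_(a in F) xvar a).

Local Notation whisker_varP := (@whisker_varP N d).

Definition zseq : seq S :=
  [seq theta c | c <- enum 'I_d] ++ [seq xvar a | a <- enum 'I_N].

Lemma size_zseq : size zseq == (d + N)%N.
Proof. by rewrite size_cat (size_map theta) (size_map xvar) !size_enum_ord. Qed.

Definition ztuple : (d + N).-tuple S := Tuple size_zseq.

Lemma nth_zseq_theta (c : 'I_d) : nth 0 zseq c = theta c.
Proof.
rewrite nth_cat size_map size_enum_ord ltn_ord (nth_map c) ?size_enum_ord //.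
by rewrite nth_ord_enum.
Qed.

Lemma nth_zseq_x (a : 'I_N) : nth 0 zseq (d + a) = xvar a.
Proof.
rewrite nth_cat size_map size_enum_ord ltnNge leq_addr /= addKn.
by rewrite (nth_map a) ?size_enum_ord // nth_ord_enum.
Qed.

Lemma theta_homog c : theta c \is 1.-homog.
Proof. by rewrite rpredD ?rpred_sum // ?dhomogX /= ?mdeg1 // => a _; rewrite dhomogX /= mdeg1. Qed.

Lemma zseq_homog p : p \in (ztuple : seq S) -> p \is 1.-homog.
Proof.
rewrite mem_cat => /orP[/mapP[c _ ->]|/mapP[a _ ->]]; first exact: theta_homog.
by rewrite dhomogX /= mdeg1.
Qed.

Lemma zseq_gen (p : S) : p.@[fun=> 0] = 0 -> ideal_adds (@zero_ideal S) ztuple p.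
Proof.
have Jid := ideal_adds_ideal zseq (@zero_ideal_ideal S).
have [J0 JD JM] := Jid.
have Jx a : ideal_adds (@zero_ideal S) zseq (xvar a).
  apply: mem_ideal_adds; first exact: zero_ideal_ideal.
  by rewrite mem_cat orbC map_f // mem_enum.
apply: mpoly_aug_ideal => //; elim/whisker_varP => [c|a]; last exact: Jx.
have -> : 'X_(lshift N c) = theta c - \sum_(a | col a == c) xvar a.
  by rewrite addrK.
apply: idealB => //; last exact: ideal_sum.
apply: mem_ideal_adds; first exact: zero_ideal_ideal.
by rewrite mem_cat map_f // mem_enum.
Qed.

Definition zsubst (g : 'I_d + 'I_N -> {poly S}) : {rmorphism S -> {poly S}} :=
  mmap (polyC \o @mpolyC (d + N) k) (fun v => g (split v)).

Lemma zsubstW g c : zsubst g (wvar c) = g (inl c).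
Proof. by rewrite /zsubst /= mmapX mmap1U split_lshift. Qed.
Lemma zsubstX g a : zsubst g (xvar a) = g (inr a).
Proof. by rewrite /zsubst /= mmapX mmap1U split_rshift. Qed.
Lemma zsubst_theta g c :
  zsubst g (theta c) = g (inl c) + \sum_(a | col a == c) g (inr a).
Proof.
rewrite rmorphD rmorph_sum [zsubst g (wvar c)]zsubstW; congr (_ + _).
by apply: eq_bigr => a _; apply: zsubstX.
Qed.

Lemma zsubst_eval g y : (forall c, (g (inl c)).[y] = wvar c) ->
  (forall a, (g (inr a)).[y] = xvar a) -> forall p, (zsubst g p).[y] = p.
Proof.
move=> gw gx p; rewrite -[LHS]/((horner_eval y \o zsubst g) p) -[RHS]/(idfun p).
apply: mpoly_rmorph_eq => [c|] /=.
  by rewrite [zsubst g _]mmapC /horner_eval hornerC.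
elim/whisker_varP => [c|a]; rewrite /horner_eval.
  by rewrite [zsubst g _]zsubstW gw.
by rewrite [zsubst g _]zsubstX gx.
Qed.

(* The coordinates z are an affine change of the variables of S: a theta is   *)
(* moved by its w alone, and an x_a by changing w_(col a) simultaneously.     *)
Lemma zseq_regular : regular_mod (@zero_ideal S) ztuple.
Proof.
apply: regular_by_subst => i; rewrite (eqP size_zseq) => lti /=.
have nth_lt j (lt_j : (j < d + N)%N) : nth 0 zseq j =
    match split (Ordinal lt_j) with inl c => theta c | inr a => xvar a end.
  by case: split_ordP => [c|a] /(congr1 val) /= ->;
     [apply: nth_zseq_theta | apply: nth_zseq_x].
rewrite nth_lt.
have [c iE|a iE] := split_ordP (Ordinal lti).
  pose g (v : 'I_d + 'I_N) : {poly S} := match v with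
    | inl c' => if c' == c then 'X - (\sum_(a | col a == c) xvar a)%:P
                else (wvar c')%:P
    | inr a => (xvar a)%:P end.
  exists (zsubst g), (theta c); split=> [|j lt_j|].
  - apply: zsubst_eval => [c'|a]; last by rewrite hornerC.
    rewrite /g; case: eqP => [->|_]; last by rewrite hornerC.
    by rewrite hornerD hornerN hornerX hornerC addrK.
  - have lt_jc : (j < c)%N by move/(congr1 val): iE => /= <-.
    have lt_jd : (j < d)%N by apply: ltn_trans lt_jc _.
    rewrite (nth_zseq_theta (Ordinal lt_jd)) zsubst_theta /g ifN.
      by rewrite -rmorph_sum -rmorphD.
    by rewrite -val_eqE /= ltn_eqF.
  - rewrite zsubst_theta /g eqxx -rmorph_sum subrK; exact: monicX.
pose g (v : 'I_d + 'I_N) : {poly S} := match v with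
  | inl c => (wvar c)%:P + (if c == col a then (xvar a)%:P - 'X else 0)
  | inr b => if b == a then 'X else (xvar b)%:P end.
exists (zsubst g), (xvar a); split=> [|j lt_j|].
- apply: zsubst_eval => [c|b]; rewrite /g; last first.
    by case: eqP => [->|_]; rewrite ?hornerX ?hornerC.
  by case: eqP => _; rewrite hornerD hornerC ?horner0 ?hornerD ?hornerN ?hornerX
    ?hornerC ?subrr addr0.
- have lt_ja : (j < d + a)%N by move/(congr1 val): iE => /= <-.
  have lt_jn : (j < d + N)%N by apply: ltn_trans lt_j lti.
  rewrite nth_lt; case: split_ordP => [c|b] /(congr1 val) /= jE.
    rewrite zsubst_theta /g; case: eqP => [->|nc].
      rewrite (bigD1 a) //= eqxx (eq_bigr (fun b => (xvar b)%:P)).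
        rewrite [RHS]rmorphD rmorph_sum [in RHS](bigD1 a) //=; ring.
      by move=> b /andP[_ /negPf ->].
    rewrite addr0 [RHS]rmorphD rmorph_sum; congr (_ + _); apply: eq_bigr => b cb.
    by case: eqP => // ba; case: nc; rewrite -ba (eqP cb).
  rewrite zsubstX /g ifN //; rewrite jE ltn_add2l in lt_ja.
  by rewrite -val_eqE /= ltn_eqF.
- rewrite zsubstX /g eqxx; exact: monicX.
Qed.

Definition zres : gr_free_resolution k (d + N) :=
  koszul_resolution zseq_homog zseq_regular zseq_gen.

Definition xgens : seq R := [seq X a | a <- enum 'I_N].

Lemma map_pi_zseq : map pi zseq = thetas ++ xgens.
Proof. by rewrite map_cat; congr (_ ++ _); rewrite -map_comp. Qed.

Lemma size_thetas : size thetas = d.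
Proof. by rewrite (size_map th) size_enum_ord. Qed.
Lemma size_xgens : size xgens = N.
Proof. by rewrite (size_map X) size_enum_ord. Qed.
Lemma size_zR : size (thetas ++ xgens) = (d + N)%N.
Proof. by rewrite size_cat size_thetas size_xgens. Qed.

Lemma tens_diffE i (v : {ffun kos_basis (d + N) i.+1 -> R}) :
  @tens_diff k _ D zres i v = free_map (@kos_diff _ R (thetas ++ xgens) i) v.
Proof.
apply/ffunP => b; rewrite !ffunE; apply: eq_bigr => a _; congr (_ * _).
rewrite -map_pi_zseq [LHS]kosz_morph; apply: kosz_ext => [|t szt].
  by rewrite size_map (eqP size_zseq) size_tuple.
by rewrite /= rmorph_nat.
Qed.

Lemma tens_cycle_kosz i (y : {ffun kos_basis (d + N) i -> R}) :
  @tens_cycle k _ D zres i y <->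
  forall s, size s = (d + N)%N -> kosz (thetas ++ xgens) (kos_ext y) s = 0.
Proof.
case: i y => [|i] y /=; split=> //.
- move=> _ s szs; rewrite -(kosz0 (thetas ++ xgens) s).
  by apply: kosz_ext_deg => [|t _ nt]; rewrite ?size_zR // kos_ext_deg // nt.
- move=> dy s szs; rewrite -kos_ext_free_map ?size_zR //.
  rewrite -tens_diffE dy /kos_ext big1 // => a _.
  by rewrite ffunE mul0r.
- move=> dy; rewrite tens_diffE; apply/ffunP => b.
  by rewrite free_map_kos dy ?ffunE // size_tuple.
Qed.

Local Notation zideal := (ideal_adds (@zero_ideal R) thetas).
Local Notation kap := (kap col).

Let zideal_ideal : is_ideal zideal.
Proof. exact/ideal_adds_ideal/zero_ideal_ideal. Qed.

Lemma zidealP p : zideal (pi p) <-> killed h col p.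
Proof. exact: thetas_killed. Qed.

(** Reduction modulo the thetas, with zero as the primitive in the reduced complex. *)
Lemma tor_boundary i (y : {ffun kos_basis (d + N) i -> R}) :
  @tens_cycle k _ D zres i y ->
  (forall s, size s = N -> zideal (kos_ext y (nseq d false ++ s))) ->
  @tens_boundary k _ D zres i y.
Proof.
move=> /tens_cycle_kosz dy yz.
have [|w ->] := kos_boundary size_zR (@regular_thetas k N d h col h_sym h_irr h_col) dy.
  exists (fun=> 0) => s; rewrite size_xgens size_thetas kosz0 subr0; exact: yz.
by exists w; rewrite tens_diffE.
Qed.

Definition maximal_clear F := clear_set h F /\
  forall a, a \notin F -> ~~ clear_set h (a |: F).

Definition cyc_vec F a : seq R :=
  [seq - ((a \in F) && (c == col a))%:R | c <- enum 'I_d] ++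
  [seq (b == a)%:R | b <- enum 'I_N].

(* The exterior product of the e_a - [a \in F] e_(col a), times the monomial  *)
(* of F, which is killed by each x_a - [a \in F] theta_(col a).               *)
Definition cyc F (l : seq 'I_N) : seq bool -> R :=
  foldr (fun a u => wedge (cyc_vec F a) u)
    (fun s => (s == nseq (d + N) false)%:R * e F) l.

Lemma size_cyc_vec F a : size (cyc_vec F a) = (d + N)%N.
Proof.
rewrite size_cat (size_map (fun c => - ((a \in F) && (c == col a))%:R)).
by rewrite (size_map (fun b => (b == a)%:R)) !size_enum_ord.
Qed.

Lemma dotp_cyc_vec F a :
  dotp (thetas ++ xgens) (cyc_vec F a) = X a - (a \in F)%:R * th (col a).
Proof.
rewrite dotp_cat; last by rewrite !size_map.
rewrite !dotp_map addrC; congr (_ + _).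
  rewrite (bigD1 a) //= eqxx mulr1 big1 ?addr0 // => b /negPf ->.
  by rewrite mulr0.
rewrite (bigD1 (col a)) //= eqxx andbT big1 ?addr0 => [|c /negPf ->].
  by rewrite mulrN mulrC.
by rewrite andbF oppr0 mulr0.
Qed.

Lemma cyc_vec_kill F a : maximal_clear F ->
  (X a - (a \in F)%:R * th (col a)) * e F = 0.
Proof.
move=> [hF maxF]; rewrite mulrBl; have [aF|aF] := boolP (a \in F).
  by rewrite mul1r pi_x_mem // subrr.
by rewrite mul0r mul0r subr0 pi_x_notin // pi_prod_dep // maxF.
Qed.

Lemma cyc_scalar F l s : size s = (d + N)%N -> exists c, cyc F l s = pi c%:MP * e F.
Proof.
elim: l s => [|a l IH] s szs; first by exists (s == nseq (d + N) false)%:R; rewrite !rmorph_nat.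
apply: (@wedge_closed _ (fun r => exists c, r = pi c%:MP * e F)).
- by exists 0; rewrite !rmorph0 mul0r.
- by move=> _ _ [c ->] [c' ->]; exists (c + c'); rewrite !rmorphD mulrDl.
- by move=> _ [c ->]; exists (- c); rewrite !rmorphN mulNr.
- by rewrite size_cyc_vec.
- move=> b t bF; rewrite size_cyc_vec => /IH[c cE].
  suff [c' ->] : exists c', b = pi c'%:MP.
    exists (c' * c); transitivity (pi c'%:MP * cyc F l t) => //.
    by rewrite cE mulrA !rmorphM.
  move: bF; rewrite mem_cat => /orP[/mapP[c' _ ->]|/mapP[c' _ ->]].
    by exists (- ((a \in F) && (c' == col a))%:R); rewrite !rmorphN !rmorph_nat.
  by exists (c' == a)%:R; rewrite !rmorph_nat.
Qed.

Lemma cyc_deg F l s : size s = (d + N)%N -> ndeg s <> size l -> cyc F l s = 0.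
Proof.
elim: l s => [|a l IH] s szs /= ns.
  case: eqP => [sE|_]; last by rewrite mul0r.
  by case: ns; rewrite sE /ndeg count_nseq.
rewrite -[RHS](wedge0 (cyc_vec F a) s).
apply: wedge_ext_deg => [|t]; first by rewrite size_cyc_vec.
by rewrite size_cyc_vec => szt nt; apply: IH => // tl; case: ns; rewrite -nt tl.
Qed.

Lemma cyc_kosz F l s : maximal_clear F -> size s = (d + N)%N ->
  kosz (thetas ++ xgens) (cyc F l) s = 0.
Proof.
move=> maxF; elim: l s => [|a l IH] s szs.
  rewrite -(kosz0 (thetas ++ xgens) s).
  apply: kosz_ext_deg => [|t]; rewrite size_zR // => szt nt.
  by apply: cyc_deg; rewrite // nt.
have := @wedge_leibniz _ (thetas ++ xgens) (cyc_vec F a) (cyc F l) s.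
rewrite size_cyc_vec size_zR => /(_ erefl szs).
have -> : wedge (cyc_vec F a) (kosz (thetas ++ xgens) (cyc F l)) s = 0.
  rewrite -[RHS](wedge0 (cyc_vec F a) s).
  apply: wedge_ext_deg => [|t]; rewrite size_cyc_vec // => szt _; exact: IH.
rewrite addr0 => ->; have [c ->] := cyc_scalar F l szs.
by rewrite mulrCA dotp_cyc_vec cyc_vec_kill // mulr0.
Qed.

(** On sequences without theta vectors only the unit-vector parts of [cyc_vec] contribute, and their
    ordered product carries no sign. *)
Lemma cyc_top F : cyc F (enum 'I_N) (nseq d false ++ nseq N true) = e F.
Proof.
have cyc_rec l t : cyc F l (nseq d false ++ t) =
    foldr (fun a v => wedge [seq (b == a)%:R | b <- iota 0 N] v)
      (fun t => (nseq d false ++ t == nseq (d + N) false)%:R * e F)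
      [seq val a | a <- l] t.
  elim: l t => [//|a l IH] t.
  pose v1 : seq R := [seq - ((a \in F) && (c == col a))%:R | c <- enum 'I_d].
  pose v2 : seq R := [seq (b == a)%:R | b <- enum 'I_N].
  have szd : size v1 = d.
    by rewrite (size_map (fun c => - ((a \in F) && (c == col a))%:R)) size_enum_ord.
  have W := wedge_head v1 v2 (cyc F l) t; rewrite szd in W.
  rewrite [LHS]W {W} /=; congr (wedge _ _ _); last by apply/funext => t'; apply: IH.
  by rewrite -val_enum_ord -map_comp.
rewrite cyc_rec val_enum_ord wedge_units -nseqD eqxx mul1r //.
Qed.

Definition cyc_class F : {ffun kos_basis (d + N) N -> R} :=
  [ffun b => cyc F (enum 'I_N) (val (val b))].

Lemma cyc_class_ext F s : size s = (d + N)%N ->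
  kos_ext (cyc_class F) s = cyc F (enum 'I_N) s.
Proof.
move=> szs; have [ns|ns] := eqVneq (ndeg s) N.
  by have [b <-] := kos_basisP szs ns; rewrite kos_extE ffunE.
rewrite kos_ext_deg; last exact/eqP.
by rewrite cyc_deg // size_enum_ord; apply/eqP.
Qed.

Lemma cyc_class_cycle F : maximal_clear F ->
  @tens_cycle k _ D zres N (cyc_class F).
Proof.
move=> maxF; apply/tens_cycle_kosz => s szs; rewrite -[RHS](cyc_kosz (enum 'I_N) maxF szs).
by apply: kosz_ext => [|t]; rewrite size_zR // => szt; apply: cyc_class_ext.
Qed.

Lemma size_top : size (nseq d false ++ nseq N true) = (d + N)%N.
Proof. by rewrite size_cat !size_nseq. Qed.

(** Modulo the thetas such a coefficient could only come from an exterior product of more than [N]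
    of the [N] vectors of the x_a. *)
Lemma boundary_top (y : {ffun kos_basis (d + N) N -> R}) :
  @tens_boundary k _ D zres N y -> zideal (kos_ext y (nseq d false ++ nseq N true)).
Proof.
case=> w ->; rewrite tens_diffE kos_ext_free_map ?size_zR ?size_top //.
have := @kosz_head _ _ thetas xgens (kos_ext w) (nseq N true) (@zero_ideal_ideal R).
rewrite size_nseq size_xgens size_thetas => /(_ erefl).
rewrite (kosz_top (z := xgens)) ?subr0 ?size_nseq ?size_xgens //.
by rewrite /ndeg count_nseq mul1n.
Qed.

Lemma reg_witness F r : maximal_clear F -> #|F| = r ->
  @tor_neq0 k _ D zres N (N + r).
Proof.
move=> maxF cardF; exists (cyc_class F); split; first exact: cyc_class_cycle.
- move=> b; right; exists r.
  have [c cE] := cyc_scalar F (enum 'I_N) (size_tuple (val b)).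
  exists (c%:MP * \prod_(a in F) xvar a); split; first exact: addnC.
    rewrite mul_mpolyC dhomogZ //.
    have -> : \prod_(a in F) xvar a = 'X_[\sum_(a in F) U_(rshift d a)].
      by rewrite mprodXE.
    rewrite dhomogX /= mdeg_sum (eq_bigr (fun=> 1%N)) => [|a _]; last exact: mdeg1.
    by rewrite sum1_card cardF.
  by rewrite ffunE cE rmorphM.
- move/boundary_top; rewrite cyc_class_ext ?size_top // cyc_top => /zidealP.
  move/(_ F (proj1 maxF)); rewrite kap_prod eqxx => /eqP; exact/negP/oner_neq0.
Qed.

(** A class in total degree [m] has coefficients of degree [m - i]; beyond [r] these have no
    coordinates, so they vanish modulo the thetas. *)
Lemma tor_vanish r i m : (forall F, clear_set h F -> (#|F| <= r)%N) ->
  @tor_neq0 k _ D zres i m -> (m <= i + r)%N.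
Proof.
move=> card_le [y [cyc_y hom_y nb_y]]; rewrite leqNgt; apply/negP => ltm.
apply: nb_y; apply: tor_boundary => // s szs; have [J0 _ _] := zideal_ideal.
have szt : size (nseq d false ++ s) = (d + N)%N by rewrite size_cat size_nseq szs.
have [ns|ns] := eqVneq (ndeg (nseq d false ++ s)) i; last first.
  by rewrite kos_ext_deg //; apply/eqP.
have [b <-] := kos_basisP szt ns; rewrite kos_extE.
case: (hom_y b) => [->//|[e' [p [/= em hp ->]]]]; apply/zidealP => F hF.
apply: (kap_homog col hp) => cardF; have := card_le F hF; rewrite cardF; lia.
Qed.

(** The cycle condition at the sequence omitting x_a puts the top coefficient in the socle of the
    quotient by the thetas. *)
Lemma cycle_top_x (y : {ffun kos_basis (d + N) N -> R}) a :
  @tens_cycle k _ D zres N y ->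
  zideal (X a * kos_ext y (nseq d false ++ nseq N true)).
Proof.
move=> /tens_cycle_kosz dy.
pose u t := kos_ext y (nseq d false ++ t).
have [||s szs us] := @kosz_corner _ xgens u a.
- by rewrite size_xgens.
- rewrite size_xgens => t szt nt; apply: kos_ext_deg.
  by rewrite /ndeg count_cat count_nseq.
have := @kosz_head _ _ thetas xgens (kos_ext y) s (@zero_ideal_ideal R) szs.
rewrite size_xgens in szs us; rewrite size_thetas dy; last first.
  by rewrite size_cat size_nseq szs.
rewrite -/u sub0r; have -> : X a = nth 0 xgens a.
  by rewrite (nth_map a) ?size_enum_ord // nth_ord_enum.
by case: us => ->; rewrite ?opprK // => /(idealN zideal_ideal); rewrite opprK.
Qed.

(** Up to boundaries, a cycle of exterior degree [N] is determined by its top coefficient modulo the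
    thetas. This is a socle element, hence a combination of the monomials of maximal independent
    sets, which are the top coefficients of the [cyc_class]. *)
Lemma tor_type t (mx : 'I_t -> {set 'I_N}) : injective mx ->
  (forall F, maximal_clear F <-> exists l, mx l = F) ->
  @tor_dim k _ D zres N t.
Proof.
move=> mx_inj mxP; have mx_max l : maximal_clear (mx l) by apply/mxP; exists l.
pose top := nseq d false ++ nseq N true.
pose comb (c : 'I_t -> k) : {ffun kos_basis (d + N) N -> R} :=
  @tens_comb k _ D zres N t c (fun l => cyc_class (mx l)).
have comb_ext c s : kos_ext (comb c) s =
    \sum_l pi (c l)%:MP * kos_ext (cyc_class (mx l)) s.
  rewrite /kos_ext; under [RHS]eq_bigr => l _ do rewrite mulr_sumr.
  rewrite exchange_big; apply: eq_bigr => b _; rewrite ffunE mulr_suml.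
  by apply: eq_bigr => l _; rewrite mulrA.
have comb_top c : kos_ext (comb c) top =
    pi (\sum_(l < t) (c l)%:MP * \prod_(a in mx l) xvar a).
  rewrite comb_ext rmorph_sum; apply: eq_bigr => l _.
  by rewrite rmorphM cyc_class_ext ?size_top // cyc_top.
exists (fun l => cyc_class (mx l)); split=> [l|y cyc_y|c]; first exact: cyc_class_cycle.
- have [p pE] := sr_pi_surj (kos_ext y top).
  exists (fun l => kap (mx l) p).
  set c := fun l => kap (mx l) p; rewrite -/(comb c).
  have zE s : kos_ext (y - comb c) s = kos_ext y s - kos_ext (comb c) s.
    rewrite /kos_ext -sumrB; apply: eq_bigr => b _.
    by rewrite [(y - comb c) b]ffunE [(- comb c) b]ffunE mulrBl.
  apply: tor_boundary => [|s szs].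
    apply/tens_cycle_kosz => s szs.
    have -> : kos_ext (y - comb c) = fun s => kos_ext y s - kos_ext (comb c) s.
      exact/funext.
    rewrite koszB (proj1 (tens_cycle_kosz y) cyc_y) // sub0r.
    have -> : kos_ext (comb c) =
        fun s => \sum_l pi (c l)%:MP * kos_ext (cyc_class (mx l)) s.
      by apply/funext => s'; apply: comb_ext.
    rewrite kosz_sum big1 ?oppr0 // => l _.
    by rewrite (proj1 (tens_cycle_kosz _) (cyc_class_cycle (mx_max l))) // mulr0.
  have [J0 _ _] := zideal_ideal.
  have szt : size (nseq d false ++ s) = (d + N)%N by rewrite size_cat size_nseq szs.
  have [ns|ns] := eqVneq (ndeg s) N; last first.
    rewrite kos_ext_deg //; apply/eqP; apply: contra ns.
    by rewrite /ndeg count_cat count_nseq.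
  have -> : s = nseq N true by rewrite -[in RHS]szs; apply: ndeg_full; rewrite ns szs.
  rewrite zE -/top comb_top -pE -rmorphB; apply/zidealP => G hG.
  rewrite kapD kapN kap_sum; apply/eqP; rewrite subr_eq0; apply/eqP.
  have [/mxP[l lG]|nG] := pselect (maximal_clear G).
    rewrite (bigD1 l) //= kapC kap_prod lG eqxx mulr1 big1 ?addr0 => [|l' ll'].
      by rewrite /c lG.
    by rewrite kapC kap_prod -lG (inj_eq mx_inj) (negPf ll') mulr0.
  rewrite big1 => [|l _]; last first.
    rewrite kapC kap_prod; case: eqP => [lG|_]; last by rewrite mulr0.
    by case: nG; rewrite -lG.
  (* A non-maximal [G] can be enlarged by some [a]; the socle condition for [a] then kills the
     coordinate at [G]. *)
  have [a aG haG] : exists2 a, a \notin G & clear_set h (a |: G).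
    apply: contrapT => nex; apply: nG; split=> // a aG; apply/negP => haG.
    by apply: nex; exists a.
  rewrite -(kap_nonmax col p aG).
  have := cycle_top_x a cyc_y; rewrite -/top -pE -rmorphM => /zidealP; exact.
- rewrite -/(comb c) => /boundary_top; rewrite -/top comb_top => /zidealP kc l.
  have := kc _ (proj1 (mx_max l)); rewrite kap_sum (bigD1 l) //= kapC kap_prod.
  rewrite eqxx mulr1 big1 ?addr0 // => l' ll'.
  by rewrite kapC kap_prod (inj_eq mx_inj) (negPf ll') mulr0.
Qed.

End WhiskerTor.

(** * Cohen-Macaulayness of a whiskered graph *)

Section Specialization.
Variables (k K : fieldType) (d : nat) (kappa : {rmorphism k -> K}) (v : 'I_d -> K).

Definition spec_var i (c : 'I_d) : {mpoly K[d]} :=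
  if (c < i)%N then (v c)%:MP else 'X_c.

(** Base change to [K] with the first [i] coordinates fixed to those of [v]. As [i] runs from 0 to
    [d], the kernels grow from zero to the ideal of the point [v]. *)
Definition spec i : {rmorphism {mpoly k[d]} -> {mpoly K[d]}} :=
  mmap (@mpolyC d K \o kappa) (spec_var i).

Lemma specC i c : spec i c%:MP = (kappa c)%:MP.
Proof. exact: mmapC. Qed.
Lemma specX i c : spec i 'X_c = spec_var i c.
Proof. by rewrite /spec /= mmapX mmap1U. Qed.

Lemma spec_mono (i : 'I_d) b : spec i b = 0 -> spec i.+1 b = 0.
Proof.
pose step : {rmorphism {mpoly K[d]} -> {mpoly K[d]}} := mmap (@mpolyC d K)
  (fun c => if c == i then (v c)%:MP else 'X_c).
have stepC a : step a%:MP = a%:MP by exact: mmapC.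
have stepX c : step 'X_c = if c == i then (v c)%:MP else 'X_c.
  by rewrite /step /= mmapX mmap1U.
have stepE : spec i.+1 b = step (spec i b).
  apply: (mpoly_rmorph_eq (f := spec i.+1) (g := step \o spec i)) => [a|c].
    by rewrite [LHS]specC [RHS](congr1 step (specC i a)) stepC.
  rewrite [LHS]specX [RHS](congr1 step (specX i c)) /spec_var ltnS leq_eqVlt.
  case: ltnP => [_|_]; first by rewrite orbT stepC.
  by rewrite orbF stepX.
by move=> bi; apply: etrans stepE (etrans (congr1 step bi) (rmorph0 step)).
Qed.

Lemma spec_eval i f c : spec i (eval_at f c) =
  (map_poly (@mpolyC d K) (map_poly kappa f)).[spec_var i c].
Proof.
rewrite /eval_at -horner_map specX -!map_poly_comp; congr (_.[_]).
by apply: eq_map_poly => a; apply: specC.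
Qed.

Lemma spec_eval_lt i f (c : 'I_d) : (c < i)%N ->
  spec i (eval_at f c) = ((map_poly kappa f).[v c])%:MP.
Proof. by move=> lt_ci; rewrite spec_eval /spec_var lt_ci horner_map. Qed.

Lemma spec_eval_neq0 (i : 'I_d) f : f \is monic -> spec i (eval_at f i) != 0.
Proof.
move=> fm; rewrite spec_eval /spec_var ltnn -/(eval_at (map_poly kappa f) i).
apply/eqP => /(congr1 (poly_var K i)); rewrite poly_var_eval eqxx rmorph0 => /eqP.
by apply/negP/monic_neq0; rewrite !map_monic.
Qed.

End Specialization.

Section WhiskerCM.
Variables (k : fieldType) (N d : nat) (h : rel 'I_N) (col : 'I_N -> 'I_d).
Hypotheses (h_sym : ssrbool.symmetric h) (h_irr : irreflexive h).
Hypothesis h_col : forall a b, a != b -> col a = col b -> h a b.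

Local Notation S := {mpoly k[d + N]}.
Local Notation B := {mpoly k[d]}.
Local Notation D := (independent_complex (whisker col h_sym h_irr)).
Local Notation R := (sr_ring k D).
Local Notation pi := (@sr_pi k _ D).
Local Notation wvar := (@wvar k N d).
Local Notation xvar := (@xvar k N d).
Local Notation theta := (theta k col).
Local Notation thetas := (@thetas k N d h col h_sym h_irr).
Implicit Types F : {set 'I_N}.

Let X a : R := pi (xvar a).
Let th c : R := pi (theta c).

Let io (b : B) : R := pi (param k col b).

(** Each vertex belongs to one of [d] whiskered cliques, and an independent set meets each at most
    once; the whiskers attain the bound. *)
Lemma clear_dim : (\max_(F in faces D) #|F|)%N = d.
Proof.
pose vcol (v : 'I_(d + N)) := match split v with inl c => c | inr a => col a end.
have vcol_l c : vcol (lshift N c) = c by rewrite /vcol split_lshift.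
have vcol_r a : vcol (rshift d a) = col a by rewrite /vcol split_rshift.
apply/eqP; rewrite eqn_leq; apply/andP; split.
  apply/bigmax_leqP => F; rewrite inE => /forall_inP hF.
  have inj : {in F &, injective vcol}.
    move=> u v /hF /forall_inP hu vF; move: (hu v vF).
    rewrite /= /whisker_edge; elim/whisker_varP: u {hu} => [c|a];
    elim/whisker_varP: v {vF} => [c'|b];
    rewrite ?vcol_l ?vcol_r ?split_lshift ?split_rshift.
    - by move=> _ ->.
    - by move=> nh cE; rewrite cE eqxx in nh.
    - by move=> nh cE; rewrite cE eqxx in nh.
    - move=> nh cE; have [->//|ab] := eqVneq a b.
      by rewrite h_col in nh.
  by rewrite -(card_in_imset inj) -[leqRHS]card_ord max_card.
have inj := @lshift_inj d N.
rewrite -[leqLHS]card_ord -(card_imset _ inj); apply: leq_bigmax_cond.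
rewrite inE; apply/forall_inP => _ /imsetP[c _ ->].
apply/forall_inP => _ /imsetP[c' _ ->] /=.
by rewrite /whisker_edge !split_lshift.
Qed.

Lemma chain_bound (a : nat -> R -> Prop) (fs : seq R) :
  (forall i, (i <= size fs)%N -> is_ideal (a i)) ->
  (forall i, (i < size fs)%N -> forall x, a i x -> a i.+1 x) ->
  (forall i, (i < size fs)%N -> a i.+1 (nth 0 fs i)) ->
  (forall i, (i < size fs)%N -> forall y, a i (nth 0 fs i * y) -> a i y) ->
  ~ a (size fs) 1 -> (size fs <= d)%N.
Proof.
move=> aid amono af areg a1.
have rhoC (F : {x | clear_set h x}) c :
    facet_proj k col h_sym h_irr F (pi c%:MP) = c%:MP.
  by rewrite facet_projE facet_mapC.
exact: (regular_chain_bound (iota := pi \o @mpolyC (d + N) k) rhoC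
  (@facet_proj_inj k N d h col h_sym h_irr h_col) aid amono af areg a1).
Qed.

Section MaximalIdeal.
Variables (P : R -> Prop) (Pmax : is_maximal P).
Let K := residue_field Pmax.
Let res : R -> K := residue Pmax.

Let resP x : res x = 0 <-> P x.
Proof. exact: residue_eq0. Qed.

(** Zariski's lemma for the residue field, which is finitely generated over [k], with the variable
    sent to the residue of [x]. *)
Lemma residue_algebraic (x : R) : exists2 f : {poly k}, f \is monic &
  P (map_poly (pi \o @mpolyC (d + N) k) f).[x].
Proof.
have cx : commr_rmorph (residue Pmax \o (pi \o @mpolyC (d + N) k)) (res x).
  by move=> a; apply: mulrC.
have gen := generated_image (@residue_surj _ _ Pmax) (@generated_sr_ring k _ D).
have genK : generated (horner_morph cx)
    (map (residue Pmax) (map pi [seq 'X_i | i <- enum 'I_(d + N)])).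
  move=> Q Qphi Qs; apply: gen Qs => a.
  by have := Qphi a%:P; rewrite horner_morphC.
have [f f0 fx] := zariski (@residue_inv _ _ Pmax) genK.
exists ((lead_coef f)^-1 *: f).
  by rewrite monicE lead_coefZ mulVf // lead_coef_eq0.
apply/resP; rewrite /res -horner_map -map_poly_comp map_polyZ hornerZ.
by rewrite [X in _ * X]fx mulr0.
Qed.

Lemma depth_eq : depth P d.
Proof.
have [_ P1 _] := Pmax; have [Pid _ _] := Pmax.
split; last first.
  move=> _ [s [<- [s1 sreg] _]].
  apply: (@chain_bound (fun i => ideal_adds (@zero_ideal R) (take i s))).
  - by move=> i _; apply/ideal_adds_ideal/zero_ideal_ideal.
  - move=> i lti x; rewrite (take_nth 0) // /ideal_adds foldl_rcons.
    exact: ideal_addl.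
  - move=> i lti; apply: mem_ideal_adds; first exact: zero_ideal_ideal.
    by rewrite (take_nth 0) // mem_rcons inE eqxx.
  - by move=> i lti y; have := sreg i lti y; rewrite !ideal_genE.
  - by rewrite take_size -ideal_genE.
have /choice[f hf] c : exists f : {poly k}, f \is monic /\
    P (map_poly (pi \o @mpolyC (d + N) k) f).[th c].
  by have [f ? ?] := residue_algebraic (th c); exists f.
pose gs := [seq eval_at (f c) c | c <- enum 'I_d].
have reg := @regular_param k N d h col h_sym h_irr h_col _
  (regular_eval (fun c => proj1 (hf c))).
have gP x : x \in map io gs -> P x.
  case/mapP=> _ /mapP[c _ ->] ->; suff -> : io (eval_at (f c) c) =
    (map_poly (pi \o @mpolyC (d + N) k) (f c)).[th c] by case: (hf c).
  rewrite /io /eval_at -!horner_map paramX -!map_poly_comp; congr (_.[_]).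
  by apply: eq_map_poly => a /=; rewrite paramC.
exists (map io gs); split=> //.
  by rewrite (size_map io) (size_map (fun c => eval_at (f c) c)) size_enum_ord.
split=> [g1|i lti y]; last by rewrite !ideal_genE; apply: reg.
by apply: P1; apply: g1.
Qed.

(* The variables outside P lie in a facet; its trace on the x-part is F0. *)
Let F0 : {set 'I_N} := [set a | res (X a) != 0].

Lemma clear_F0 : clear_set h F0.
Proof.
apply/forall_inP => a; rewrite inE => Xa; apply/forall_inP => b; rewrite inE => Xb.
apply/negP => hab; have := mulf_neq0 Xa Xb.
by rewrite -rmorphM pi_xx // rmorph0 eqxx.
Qed.

Let spec_th := spec (residue Pmax \o (pi \o @mpolyC (d + N) k)) (fun c => res (th c)).

Lemma res_x_notin a : a \notin F0 -> res (X a) = 0.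
Proof. by rewrite inE negbK => /eqP. Qed.

(** With all coordinates fixed, the projection to the facet of [F0] becomes the residue map. For [a]
    in [F0] the relation theta x = x^2 and the invertibility of x_a modulo [P] identify the residues
    of x_a and theta; off the facet both sides are zero. *)
Lemma spec_d p : spec_th d (facet_map k col F0 p) = (res (pi p))%:MP.
Proof.
pose f := spec_th d \o facet_map k col F0.
pose g := @mpolyC d K \o (residue Pmax \o pi).
rewrite -[LHS]/(f p) -[RHS]/(g p).
apply: mpoly_rmorph_eq => [c|]; rewrite /f /g /=.
  by rewrite [facet_map _ _ _ _]facet_mapC [LHS]specC.
elim/whisker_varP => [c|a].
  rewrite [facet_map _ _ _ _]facet_mapW; case: ifP => [/imsetP[a aF ->]|cF].
    rewrite rmorph0; have := @pi_wx k N d h col h_sym h_irr a.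
    move=> /(congr1 res); rewrite [LHS]rmorphM [RHS]rmorph0 => /eqP.
    rewrite mulf_eq0 => /orP[/eqP|Xa]; first by rewrite /res => ->; rewrite mpolyC0.
    by move: aF; rewrite inE => /negP; case.
  rewrite [spec_th _ _]specX /spec_var ltn_ord; congr _%:MP.
  rewrite /th pi_thetaE [LHS]rmorphD rmorph_sum big1 ?addr0 // => a /eqP ca.
  by apply: res_x_notin; apply: contraFN cF => aF; rewrite -ca imset_f.
rewrite [facet_map _ _ _ _]facet_mapX; case: ifP => [aF|/negbT /res_x_notin Xa].
  rewrite [spec_th _ _]specX /spec_var ltn_ord; congr _%:MP.
  have := congr1 res (@pi_theta_x k N d h col h_sym h_irr h_col a).
  rewrite [LHS]rmorphM [RHS]rmorphM; apply: mulIf.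
  by move: aF; rewrite inE.
by rewrite rmorph0 -/(res _) [res _]Xa mpolyC0.
Qed.

(** The kernel of a map to a polynomial ring over a field, hence prime; at [i = d] it is [P] by
    [spec_d]. *)
Definition chain i (r : R) : Prop :=
  spec_th i (facet_proj k col h_sym h_irr (exist _ F0 clear_F0) r) = 0.

Lemma chain_d r : chain d r <-> P r.
Proof.
have [p <-] := sr_pi_surj r; rewrite /chain facet_projE spec_d -resP.
by split=> [/eqP|->]; rewrite ?mpolyC0 // mpolyC_eq0 => /eqP.
Qed.

Lemma chain_prime i : is_prime (chain i).
Proof.
split.
- split=> [|x y hx hy|a x hx]; first by rewrite /chain !rmorph0.
    by rewrite /chain !rmorphD hx hy addr0.
  by rewrite /chain !rmorphM hx mulr0.
- by rewrite /chain !rmorph1 => /eqP; rewrite oner_eq0.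
- move=> x y /eqP; rewrite !rmorphM mulf_eq0.
  by case/orP=> /eqP; [left | right].
Qed.

Lemma chain_mono (i : 'I_d) r : chain i r -> chain i.+1 r.
Proof. exact: spec_mono. Qed.

(** The witness is a monic polynomial in theta_i that vanishes at its residue: nonzero while the
    coordinate [i] is free, zero once it is fixed. *)
Lemma chain_strict (i : 'I_d) : exists2 r, chain i.+1 r & ~ chain i r.
Proof.
have [f fm fP] := residue_algebraic (th i).
have ioE b : facet_proj k col h_sym h_irr (exist _ F0 clear_F0) (io b) = b.
  by rewrite facet_projE; apply: facet_map_param clear_F0.
exists (io (eval_at f i)); rewrite /chain ioE; last exact/eqP/spec_eval_neq0.
rewrite [LHS]spec_eval_lt // -[RHS](mpolyC0 d K) map_poly_comp; congr _%:MP.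
exact: etrans (horner_map _ _ _) (proj2 (resP _) fP).
Qed.

Lemma height_eq : height P d.
Proof.
split.
  exists chain; split=> [i _|i lti|r]; [exact: chain_prime| |exact: chain_d].
  split; first exact: (chain_mono (i := Ordinal lti)).
  exact: (chain_strict (Ordinal lti)).
move=> m [p [pprime pchain pP]].
(* An element outside the prime [p i] is regular modulo it, so picking one in each step makes the
   prime chain an input for [chain_bound]. *)
have /choice[x hx] i : exists x, (i < m)%N -> p i.+1 x /\ ~ p i x.
  have [lti|_] := boolP (i < m)%N; last by exists 0.
  by have [_ [x ? ?]] := pchain i lti; exists x.
have szx : size (mkseq x m) = m by exact: size_mkseq.
have := @chain_bound p (mkseq x m); rewrite szx.
apply=> [i lti|i lti|i lti|i lti y|].
- by have [] := pprime i lti.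
- by have [] := pchain i lti.
- by rewrite nth_mkseq //; have [] := hx i lti.
- rewrite nth_mkseq // => hy; have [_ _ pM] := pprime i (ltnW lti).
  by case: (pM _ _ hy) => // hxi; have [_ []] := hx i lti.
- by have [_ p1 _] := pprime m (leqnn m).
Qed.

End MaximalIdeal.

Lemma whisker_cohen_macaulay : cohen_macaulay k D.
Proof.
split=> [|P Pmax]; first exact: noetherian_sr_ring.
by exists d; [apply: depth_eq | apply: height_eq].
Qed.

End WhiskerCM.

(** * Whiskering complete multipartite graphs *)

Section Blocks.
Variables (d r t : nat) (r_gt0 : (0 < r)%N) (le_rd : (r <= d)%N).
Hypothesis d_le_rt : (d <= r * t)%N.

Definition block_edge : rel 'I_(r * t) := fun a b => (a %/ r != b %/ r)%N.

Lemma block_sym : ssrbool.symmetric block_edge.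
Proof. by move=> a b; rewrite /block_edge eq_sym. Qed.

Lemma block_irrefl : irreflexive block_edge.
Proof. by move=> a; rewrite /block_edge eqxx. Qed.

Lemma d_gt0 : (0 < d)%N. Proof. exact: leq_trans le_rd. Qed.

Definition block_col (a : 'I_(r * t)) : 'I_d := Ordinal (ltn_pmod a d_gt0).

(** Distinct numbers in the same block of length [r <= d] cannot be congruent modulo [d], so each
    residue class is a clique. *)
Lemma block_col_edge a b : a != b -> block_col a = block_col b -> block_edge a b.
Proof.
move=> ab /(congr1 val) /= eq_mod; apply: contra ab => /eqP eq_div.
apply/eqP/val_inj; rewrite /= (divn_eq a r) (divn_eq b r) eq_div; congr (_ + _)%N.
move/eqP: eq_mod; rewrite {1}(divn_eq a r) {1}(divn_eq b r) eq_div eqn_modDl.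
rewrite (modn_small (leq_trans (ltn_pmod a r_gt0) le_rd)).
by rewrite (modn_small (leq_trans (ltn_pmod b r_gt0) le_rd)) => /eqP.
Qed.

Lemma block_lt (l : 'I_t) (j : 'I_r) : (l * r + j < r * t)%N.
Proof.
have ltj := ltn_ord j; have ltl := ltn_ord l; rewrite mulnC [(r * t)%N]mulnC.
apply: leq_trans (leq_mul ltl (leqnn r)).
by rewrite mulSn [(r * l)%N]mulnC addnC ltn_add2r.
Qed.

Definition block (l : 'I_t) : {set 'I_(r * t)} :=
  [set Ordinal (block_lt l j) | j in 'I_r].

Lemma mem_block l a : (a \in block l) = (a %/ r == l)%N.
Proof.
apply/imsetP/eqP => [[j _ ->] /=|al].
  by rewrite divnMDl // divn_small ?addn0.
exists (Ordinal (ltn_pmod a r_gt0)) => //; apply/val_inj => /=.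
by rewrite -al -divn_eq.
Qed.

Lemma card_block l : #|block l| = r.
Proof.
rewrite card_imset ?card_ord // => i j /(congr1 val) /= /addnI; exact: val_inj.
Qed.

Lemma div_lt (a : 'I_(r * t)) : (a %/ r < t)%N.
Proof. by rewrite ltn_divLR // [(t * r)%N]mulnC. Qed.

Lemma clear_block_sub F (a : 'I_(r * t)) : clear_set block_edge F -> a \in F ->
  F \subset block (Ordinal (div_lt a)).
Proof.
move=> hF aF; apply/subsetP => b bF; rewrite mem_block /=.
by have := clear_setP hF bF aF; rewrite negbK.
Qed.

Lemma block_clear l : clear_set block_edge (block l).
Proof.
apply/forall_inP => a; rewrite mem_block => /eqP al.
by apply/forall_inP => b; rewrite mem_block /block_edge al => /eqP->; rewrite negbK.
Qed.

Lemma card_clear F : clear_set block_edge F -> (#|F| <= r)%N.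
Proof.
move=> hF; have [->|[a aF]] := set_0Vmem F; first by rewrite cards0.
rewrite -[leqRHS](card_block (Ordinal (div_lt a))).
by apply/subset_leq_card/clear_block_sub.
Qed.

Lemma block_inj : injective block.
Proof.
move=> l l' eq_l; apply/val_inj => /=.
have : Ordinal (block_lt l (Ordinal r_gt0)) \in block l by apply: imset_f.
rewrite eq_l mem_block /= divnMDl // div0n addn0.
by move/eqP.
Qed.

Lemma block_maximal F :
  maximal_clear block_edge F <-> exists l, block l = F.
Proof.
split=> [[hF maxF]|[l <-]]; last first.
  split=> [|a]; first exact: block_clear.
  rewrite mem_block => al; apply/negP => /clear_setP /(_ (setU11 _ _)).
  move=> /(_ (Ordinal (block_lt l (Ordinal r_gt0)))).
  rewrite inE imset_f ?orbT // /block_edge /= divnMDl // div0n addn0 al.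
  by move/(_ isT).
(* The empty set is not maximal, because the graph has a vertex. *)
have [a aF] : exists a, a \in F.
  have [F0|[a aF]] := set_0Vmem F; last by exists a.
  have lt0 : (0 < r * t)%N by apply: leq_trans d_le_rt; apply: d_gt0.
  have := maxF (Ordinal lt0); rewrite F0 inE => /(_ isT) /negP[].
  apply/forall_inP => b; rewrite !inE orbF => /eqP->.
  by apply/forall_inP => c; rewrite !inE orbF => /eqP->; rewrite block_irrefl.
exists (Ordinal (div_lt a)); apply/eqP; rewrite eqEsubset clear_block_sub // andbT.
apply/subsetP => b bl; apply/negPn/negP => /maxF /negP[].
apply: clear_sub (block_clear (Ordinal (div_lt a))).
by rewrite subUset sub1set bl clear_block_sub.
Qed.

Definition block_graph : sgraph (d + r * t) :=
  whisker block_col block_sym block_irrefl.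

(** Since [d <= r * t], every residue class contains a vertex, namely the residue itself, so every
    whisker has a neighbour. *)
Lemma block_graph_no_isolated : no_isolated block_graph.
Proof.
move=> v; rewrite -(splitK v); case: (split v) => [c|a].
  have lt_c : (c < r * t)%N by apply: leq_trans d_le_rt.
  exists (rshift d (Ordinal lt_c)).
  rewrite /= /whisker_edge split_lshift split_rshift -val_eqE /=.
  by rewrite modn_small.
exists (lshift _ (block_col a)).
by rewrite /= /whisker_edge split_lshift split_rshift.
Qed.

End Blocks.

Theorem theorem1p3 (k : fieldType) (d r t : nat)
    (hr : (2 <= r)%N) (ht : (2 <= t)%N) (hrd : (r <= d)%N)
    (hdrt : (d <= r * t)%N) :
  exists (n : nat) (G : sgraph n),
    no_isolated G /\
    cohen_macaulay k (independent_complex G) /\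
    scdim (independent_complex G) = d%:Z - 1 /\
    has_reg k (independent_complex G) r /\
    has_type k (independent_complex G) t.
Proof.
have r_gt0 : (0 < r)%N by apply: leq_trans hr.
have maxP := @block_maximal d r t r_gt0 hrd hdrt.
have colE := @block_col_edge d r t r_gt0 hrd.
have dimE : scdim (independent_complex (block_graph t r_gt0 hrd)) = d%:Z - 1.
  by rewrite /scdim clear_dim.
exists (d + r * t)%N, (block_graph t r_gt0 hrd); split.
  exact: block_graph_no_isolated.
split; first exact: whisker_cohen_macaulay.
split=> //; split.
  exists (zres k (block_col r_gt0 hrd)); split.
    (* Any block is a maximal independent set of size [r], so its class attains the regularity. *)
    exists (r * t)%N; pose l : 'I_t := Ordinal (ltnW ht).
    have maxl := proj2 (maxP (block r l)) (ex_intro _ l erefl).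
    exact: (reg_witness k (@block_sym r t) (@block_irrefl r t) colE maxl (card_block r l)).
  move=> i m; move/(tor_vanish colE (@card_clear r t r_gt0)) => le_m.
  by lia.
(* The codimension is the number of vertices before whiskering, the exterior degree of the classes
   [cyc_class]. *)
exists (zres k (block_col r_gt0 hrd)), (r * t)%N; split.
  by rewrite dimE; lia.
exact: (tor_type k (@block_sym r t) (@block_irrefl r t) colE (@block_inj r t r_gt0) maxP).
Qed.
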